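(* Let $k$ be a field (not necessarily infinite), let $\mathfrak A=k[x_{1,0},\ldots,x_{1,d_1}]\otimes_k\cdots\otimes_kk[x_{r,0},\ldots,x_{r,d_r}]$ be the standard $\mathbb{N}^r$-graded polynomial ring and $\mathbb{P}=\mathrm{MultiProj}(\mathfrak A)=\mathbb{P}_k^{d_1}\times_k\cdots\times_k\mathbb{P}_k^{d_r}$. Let $X\subset\mathbb{P}$ be a closed subscheme and let $\mathbf n\in\mathbb{N}^r$ with $|\mathbf n|=\dim(X)$. For $1\le i\le r$, let $H_{i,1},\ldots,H_{i,n_i}\subset\mathbb{P}$ be a sequence of hyperplanes in the $i$-th component of $\mathbb{P}$. Suppose that $$H_{1,1},\ldots,H_{1,n_1},\ \ldots,\ H_{i,1},\ldots,H_{i,n_i},\ \ldots,\ H_{r,1},\ldots,H_{r,n_r}\subset\mathbb{P}$$ is a filter-regular sequence of hyperplanes on $X$. Then $$\deg_{\mathbb{P}}^{\mathbf n}(X)=\deg_k\Big(X\cap\bigcap_{\substack{1\le i\le r\\1\le j\le n_i}}H_{i,j}\Big).$$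
   Context: $\deg(x_{i,j})=\mathbf e_i\in\mathbb{N}^r$ (standard basis vector); $|\mathbf n|=n_1+\cdots+n_r$. $\mathfrak N=\bigoplus_{\nu_1>0,\ldots,\nu_r>0}[\mathfrak A]_\nu$ is the irrelevant ideal; for a quotient $\mathfrak A/\mathcal J$ by a graded ideal, $\mathrm{MultiProj}(\mathfrak A/\mathcal J)$ is the multiprojective scheme whose points are the graded primes not containing the image of $\mathfrak N$, a closed subscheme of $\mathbb{P}$. Intersections are scheme-theoretic. Multidegree: if $X=\mathrm{MultiProj}(\mathfrak A/\mathcal J)$ with $\mathcal J\subset\mathfrak A$ a graded ideal, then for $\mathbf n\in\mathbb{N}^r$ with $|\mathbf n|=\dim(X)$, $\deg_{\mathbb{P}}^{\mathbf n}(X):=e(\mathbf n;\mathfrak A/\mathcal J)$, where $\dim_k([\mathfrak A/\mathcal J]_\nu)$ agrees for $\nu\gg\mathbf 0$ with a polynomial $P(\nu)$ of total degree $\dim(X)$, written $P=\sum_{m_1,\ldots,m_r\ge0}e(m_1,\ldots,m_r)\binom{X_1+m_1}{m_1}\cdots\binom{X_r+m_r}{m_r}$, and $e(\mathbf n;\mathfrak A/\mathcal J)=e(n_1,\ldots,n_r)$. Degree: for a $k$-scheme $Y$ of finite type with $\dim(Y)=0$, $\deg_k(Y)=\sum_{y\in Y}[k(y):k]\,\mathrm{length}(\mathcal O_{Y,y})$, with $k(y)$ the residue field of $\mathcal O_{Y,y}$; for $Y=\emptyset$ the degree is $0$ (empty sum). Hyperplanes: a hyperplane in the $i$-th component of $\mathbb{P}$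 is $H=V_{++}(h)$, the closed subscheme defined by some $h\in[\mathfrak A]_{\mathbf e_i}$. A homogeneous element $z$ is filter-regular on a finitely generated graded module $M$ if $z\notin\mathfrak p$ for all $\mathfrak p\in\mathrm{Ass}(M)$ with $\mathfrak p\not\supseteq\mathfrak N$. $H=V_{++}(h)$ is a filter-regular hyperplane on $X=\mathrm{MultiProj}(\mathfrak A/\mathcal J)$ if $h$ is filter-regular on $\mathfrak A/\mathcal J$. A sequence $H_1,\ldots,H_m$ is a filter-regular sequence of hyperplanes on $X$ if $H_l$ is a filter-regular hyperplane on the closed subscheme $X\cap H_1\cap\cdots\cap H_{l-1}$ for all $1\le l\le m$. *)

(* Defs.v *)
From HB Require Import structures.
From mathcomp Require Import all_boot all_order all_algebra.
From mathcomp Require Import boolp classical_sets.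
From mathcomp Require Import generic_quotient ring_quotient fraction mpoly.

Set Implicit Arguments.
Unset Strict Implicit.
Unset Printing Implicit Defensive.

Import GRing.Theory.

Local Open Scope classical_set_scope.
Local Open Scope ring_scope.
Local Open Scope quotient_scope.

(* Possibly improper ideals with a Prop-valued membership (the structure
   [idealr] of ring_quotient is for proper ideals and boolean predicates). *)
Record ideal (R : comNzRingType) := Ideal {
  ideal_set :> R -> Prop;
  ideal0 : ideal_set 0;
  idealD : forall x y, ideal_set x -> ideal_set y -> ideal_set (x + y);
  idealM : forall a x, ideal_set x -> ideal_set (a * x) }.

Definition prime_ideal (R : comNzRingType) (p : ideal R) : Prop :=
  ~ p 1 /\ forall x y, p (x * y) -> p x \/ p y.

Section AddGens.
Variables (R : comNzRingType) (I : ideal R) (hs : seq R).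

Definition addgens_set : set R :=
  [set x | exists a, I a /\
     exists c : 'I_(size hs) -> R, x = a + \sum_l c l * hs`_l].

Lemma addgens0 : addgens_set 0.
Proof.
exists 0; split; first exact: ideal0.
by exists (fun=> 0); rewrite add0r big1 // => l _; rewrite mul0r.
Qed.

Lemma addgensD x y : addgens_set x -> addgens_set y -> addgens_set (x + y).
Proof.
move=> [a [Ia [c ->]]] [b [Ib [c' ->]]]; exists (a + b).
split; first exact: idealD.
exists (fun l => c l + c' l); rewrite addrACA -big_split /=.
by congr (_ + _); apply: eq_bigr => l _; rewrite mulrDl.
Qed.

Lemma addgensM z x : addgens_set x -> addgens_set (z * x).
Proof.
move=> [a [Ia [c ->]]]; exists (z * a); split; first exact: idealM.
exists (fun l => z * c l); rewrite mulrDr mulr_sumr.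
by congr (_ + _); apply: eq_bigr => l _; rewrite mulrA.
Qed.

(* I + (hs) *)
Definition addgens : ideal R := Ideal addgens0 addgensD addgensM.

End AddGens.

(* [n] is the supremum of the lengths of the chains C_0 < ... < C_n of sets
   satisfying [P]. *)
Definition sup_chain_length (T : Type) (P : set T -> Prop) (n : nat) : Prop :=
  let chain m (C : nat -> set T) :=
    (forall i, (i <= m)%N -> P (C i)) /\
    (forall i, (i < m)%N -> C i `<` C i.+1) in
  (exists C, chain n C) /\ (forall m C, chain m C -> (m <= n)%N).

(* Length of R as a module over itself. *)
Definition ring_length (R : comNzRingType) (n : nat) : Prop :=
  sup_chain_length (fun S : set R => exists I : ideal R, S = I) n.

(* dim_k (U / W) = n, for k-subspaces W of U of a ring in which [c] in k acts
   as multiplication by [phi c]: the [b i] form a basis of U modulo W. *)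
Definition quot_dim (k : fieldType) (R : comNzRingType) (phi : k -> R)
    (U W : set R) (n : nat) : Prop :=
  exists b : 'I_n -> R, (forall i, U (b i)) /\
    forall u, U u ->
      exists! c : {ffun 'I_n -> k}, W (u - \sum_i phi (c i) * b i).

(* The non-invertible elements: the maximal ideal when R is local. *)
Definition nonunits (R : comNzRingType) : set R :=
  [set x | forall y, x * y <> 1].

(* [R / m : k] for a local ring R with maximal ideal m. *)
Definition residue_degree (k : fieldType) (R : comNzRingType) (phi : k -> R)
    (n : nat) : Prop :=
  quot_dim phi setT (@nonunits R) n.

(* The variables are the x_(i,j) with i < r and j <= d i. *)
Definition mvar (r : nat) (d : 'I_r -> nat) := {i : 'I_r & 'I_(d i).+1}.
Definition nvars (r : nat) (d : 'I_r -> nat) : nat := #|{: mvar d}|.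

Notation multiring k d := {mpoly k[nvars d]}.

Section MultiProj.
Variables (k : fieldType) (r : nat) (d : 'I_r -> nat).

Local Notation A := (multiring k d).
Local Notation K := {fraction A}.
Local Notation "x %:F" := (tofrac x).
Implicit Types (nu : 'X_{1..r}) (J : ideal A).

(* The [l]-th variable x_(i,j) has degree e_i. *)
Definition vdeg (l : 'I_(nvars d)) : 'X_{1..r} := U_(tag (enum_val l))%MM.

Definition multideg (m : 'X_{1..nvars d}) : 'X_{1..r} :=
  (\sum_l vdeg l *+ m l)%MM.

(* [A]_nu *)
Definition homogeneous nu : set A :=
  [set f | forall m, m \in msupp f -> multideg m = nu].

Definition hcomp nu (f : A) : A :=
  \sum_(m <- msupp f | multideg m == nu) f@_m *: 'X_[m].

Definition graded_ideal J : Prop := forall f nu, J f -> J (hcomp nu f).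

Definition irrelevant : set A :=
  [set f | forall m, m \in msupp f -> forall i, (0 < multideg m i)%N].

(* The points of MultiProj(A/J). *)
Record multiproj J := MultiProj {
  pt_ideal :> ideal A;
  pt_prime : prime_ideal pt_ideal;
  pt_graded : graded_ideal pt_ideal;
  pt_relevant : ~ (irrelevant `<=` pt_ideal);
  pt_sub : J `<=` pt_ideal }.

Section Topology.
Variable J : ideal A.

Definition closed_set (Z : set (multiproj J)) : Prop :=
  exists I : ideal A, graded_ideal I /\ Z = [set p | I `<=` p].

Definition irreducible_closed (Z : set (multiproj J)) : Prop :=
  [/\ closed_set Z, Z !=set0 &
      forall Z1 Z2, closed_set Z1 -> closed_set Z2 -> Z = Z1 `|` Z2 ->
        Z = Z1 \/ Z = Z2].

(* dim(MultiProj(A/J)) = D; in particular the space is nonempty. *)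
Definition dim_multiproj (D : nat) : Prop :=
  sup_chain_length irreducible_closed D.

End Topology.

Lemma homogB nu f g : homogeneous nu f -> homogeneous nu g -> homogeneous nu (f - g).
Proof.
move=> hf hg m /msuppB_le; rewrite mem_cat => /orP[/hf|/hg] //.
Qed.

Lemma multidegD m1 m2 :
  multideg (m1 + m2)%MM = (multideg m1 + multideg m2)%MM.
Proof.
rewrite /multideg -big_split /=; apply: eq_bigr => l _.
by apply/mnmP=> i; rewrite !(mnmDE, mulmnE) mulnDr.
Qed.

Lemma homogM mu nu f g : homogeneous mu f -> homogeneous nu g -> homogeneous (mu + nu)%MM (f * g).
Proof.
move=> hf hg m /msuppM_le /allpairsP[[m1 m2] /= [m1f m2g ->]].
by rewrite multidegD (hf _ m1f) (hg _ m2g).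
Qed.

Lemma homogC c : homogeneous 0%MM c%:MP.
Proof.
move=> m; rewrite msuppC; case: eqP => // _; rewrite inE => /eqP->.
rewrite /multideg big1 // => l _; apply/mnmP=> i.
by rewrite mulmnE mnm0E muln0 mnm0E.
Qed.

Section Stalk.
Variables (J : ideal A) (y : multiproj J).

Lemma pt_neq0 (g : A) : ~ y g -> g%:F != 0 :> K.
Proof.
move=> yg; rewrite tofrac_eq0; apply/eqP => g0.
by apply: yg; rewrite g0; apply: ideal0.
Qed.

Lemma pt_mul (f g : A) : ~ y f -> ~ y g -> ~ y (f * g).
Proof. by move=> yf yg /(pt_prime y).2 []. Qed.

Lemma pt_one : ~ y 1. Proof. exact: (pt_prime y).1. Qed.

(* The stalk of O_P at y: the degree-zero part of the localization of A at the
   homogeneous elements outside y, inside the fraction field of A. *)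
Definition ambient_pred : {pred K} := fun z =>
  `[< exists nu f g, [/\ homogeneous nu f, homogeneous nu g, ~ y g & z = f%:F / g%:F] >].

Lemma ambient_subring : GRing.subring_closed ambient_pred.
Proof.
split.
- apply/asboolP; exists 0%MM, 1, 1; split.
  + exact: homogC.
  + exact: homogC.
  + exact: pt_one.
  + by rewrite tofrac1 divr1.
- move=> u v /asboolP[nu [f [g [hf hg yg ->]]]].
  move=> /asboolP[nu' [f' [g' [hf' hg' yg' ->]]]].
  apply/asboolP; exists (nu + nu')%MM, (f * g' - f' * g), (g * g'); split.
  + apply: homogB; first exact: homogM.
    by rewrite [f' * g]mulrC; apply: homogM.
  + exact: homogM.
  + exact: pt_mul.
  + by rewrite -mulNr addf_div ?pt_neq0// tofracB !tofracM mulNr.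
- move=> u v /asboolP[nu [f [g [hf hg yg ->]]]].
  move=> /asboolP[nu' [f' [g' [hf' hg' yg' ->]]]].
  apply/asboolP; exists (nu + nu')%MM, (f * f'), (g * g'); split.
  + exact: homogM.
  + exact: homogM.
  + exact: pt_mul.
  + by rewrite mulf_div !tofracM.
Qed.

HB.instance Definition _ :=
  GRing.isSubringClosed.Build K ambient_pred ambient_subring.

Record ambient_stalk := AmbientStalk {
  ambient_val : K;
  ambient_valP : ambient_val \in ambient_pred }.

HB.instance Definition _ := [isSub for ambient_val].
HB.instance Definition _ := [Choice of ambient_stalk by <:].
HB.instance Definition _ :=
  [SubChoice_isSubComNzRing of ambient_stalk by <:].

(* The stalk at y of the ideal sheaf of MultiProj(A/J). *)
Definition ideal_stalk : {pred ambient_stalk} := fun z =>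
  `[< exists nu f g, [/\ homogeneous nu f, homogeneous nu g, J f, ~ y g &
        ambient_val z = f%:F / g%:F] >].

Lemma ideal_stalk_closed : idealr_closed ideal_stalk.
Proof.
split.
- apply/asboolP; exists 0%MM, 0, 1; split.
  + by move=> m; rewrite msupp0.
  + exact: homogC.
  + exact: ideal0.
  + exact: pt_one.
  + by rewrite tofrac0 mul0r.
- apply/negP => /asboolP[nu [f [g [hf hg Jf yg]]]].
  rewrite (_ : ambient_val 1 = 1) // => /esym /divr1_eq /eqP.
  by rewrite tofrac_eq => /eqP fg; apply: yg; rewrite -fg; apply: pt_sub.
- move=> [a aP] u v; move/asboolP: (aP) => [mu [p [q [hp hq yq aE]]]].
  move=> /asboolP[nu [f [g [hf hg Jf yg uE]]]].
  move=> /asboolP[nu' [f' [g' [hf' hg' Jf' yg' vE]]]].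
  apply/asboolP.
  exists (mu + nu + nu')%MM, (p * f * g' + f' * (q * g)), (q * g * g'); split.
  + rewrite -[f' * _]opprK; apply: homogB; first by do 2![apply: homogM => //].
    rewrite mulrC -mulNr; apply: homogM => //.
    by rewrite -sub0r; apply: homogB; [move=> m; rewrite msupp0 | apply: homogM].
  + by do 2![apply: homogM => //].
  + apply: idealD; last by rewrite mulrC; apply: idealM.
    by rewrite mulrAC; apply: idealM.
  + by do 2![apply: pt_mul => //].
  + transitivity (a * ambient_val u + ambient_val v); first by [].
    rewrite aE uE vE mulf_div addf_div ?mulf_neq0 ?pt_neq0//.
    by rewrite tofracD !tofracM.
Qed.

HB.instance Definition _ :=
  isIdealr.Build ambient_stalk ideal_stalk ideal_stalk_closed.

(* O_(X,y) = O_(P,y) / I_(X,y) for X = MultiProj(A/J). *)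
Definition stalk : comNzRingType := {ideal_quot ideal_stalk}.

Lemma ambient_scalar (c : k) : (c%:MP : A)%:F \in ambient_pred.
Proof.
apply/asboolP; exists 0%MM, c%:MP, 1; split.
- exact: homogC.
- exact: homogC.
- exact: pt_one.
- by rewrite tofrac1 divr1.
Qed.

Definition stalk_scalar (c : k) : stalk :=
  \pi_{ideal_quot ideal_stalk} (AmbientStalk (ambient_scalar c)).

End Stalk.

(* deg_k(MultiProj(A/J)) = D: there are finitely many points, their residue
   fields are finite over k and their local rings have finite length. *)
Definition scheme_degree J (D : nat) : Prop :=
  exists (s : nat) (y : 'I_s -> multiproj J) (deg len : 'I_s -> nat),
    [/\ bijective y,
        forall i, residue_degree (@stalk_scalar J (y i)) (deg i),
        forall i, ring_length (stalk (y i)) (len i) &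
        D = (\sum_i deg i * len i)%N].

(* dim_k [A/J]_nu = n *)
Definition hilbert_function J nu (n : nat) : Prop :=
  quot_dim (fun c => c%:MP) (homogeneous nu) (J `&` homogeneous nu) n.

(* dim_k [A/J]_nu = P(nu) for all nu >> 0. Such a P is unique, hence its total
   degree need not be prescribed. *)
Definition hilbert_polynomial J (P : {mpoly rat[r]}) : Prop :=
  exists nu0, forall nu, (forall i, (nu0 i <= nu i)%N) ->
    exists2 n : nat, hilbert_function J nu n & P.@[fun i => (nu i)%:R] = n%:R.

(* \prod_i binomial(X_i + m_i, m_i) *)
Definition binomial_mpoly (m : 'X_{1..r}) : {mpoly rat[r]} :=
  \prod_(i < r) ((m i)`!%:R^-1 *: \prod_(1 <= j < (m i).+1) ('X_i + j%:R)).

(* deg_P^n(MultiProj(A/J)) = e(n; A/J) = e *)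
Definition multidegree J (n : 'X_{1..r}) (e : rat) : Prop :=
  exists (P : {mpoly rat[r]}) (c : 'X_{1..r} -> rat) (D : nat),
    [/\ hilbert_polynomial J P,
        forall m, (D <= mdeg m)%N -> c m = 0,
        P = \sum_(m : 'X_{1..r < D}) c m *: binomial_mpoly m &
        c n = e].

(* p = Ann_A(f mod J) for some f in A *)
Definition associated J (p : ideal A) : Prop :=
  prime_ideal p /\ exists f, forall a, p a <-> J (a * f).

Definition filter_regular J (z : A) : Prop :=
  forall p, associated J p -> ~ (irrelevant `<=` p) -> ~ p z.

(* MultiProj(A/J) cut by V(z_1), ..., V(z_l) is MultiProj of A/(J + (z_1..z_l)). *)
Definition filter_regular_seq J (zs : seq A) : Prop :=
  forall l, (l < size zs)%N -> filter_regular (addgens J (take l zs)) zs`_l.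

(* h_(1,1), ..., h_(1,n_1), ..., h_(r,1), ..., h_(r,n_r) *)
Definition hyperplane_seq (n : 'X_{1..r}) (h : forall i : 'I_r, 'I_(n i) -> A)
    : seq A :=
  [seq h i j | i <- enum 'I_r, j <- enum 'I_(n i)].

End MultiProj.

(* Main.v *)
(* Cutting A/J by a filter-regular h of degree e_i gives, in large degrees, the
   exact sequence 0 -> (A/J)(-e_i) -> A/J -> A/(J + h) -> 0, so the Hilbert
   polynomial is replaced by its backward difference in the i-th direction; on the
   basis of the products of binomials this shifts the coefficients. After all the
   cuts the coefficient e(n) has become the constant coefficient. Each cut also
   lowers the dimension: a relevant prime over J + h contains an associated prime
   of J, which is relevant and hence misses h. So the final ideal J' has no strict
   inclusions between its points.

   A prime filtration of A/J', with quotients A/p_i up to shift, computes both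
   sides. For irrelevant p_i the Hilbert function of A/p_i vanishes in large
   degrees; for relevant p_i, which is then a maximal point, it is eventually the
   constant [k(p_i) : k]. Localized at a point y, the filtration has exactly one
   simple factor for each i with p_i = y, and these are counted by the length of
   the local ring. *)

From HB Require Import structures.
Require Import Defs.
From mathcomp Require Import all_boot all_order all_algebra.
From mathcomp Require Import boolp classical_sets.
From mathcomp Require Import generic_quotient ring_quotient fraction mpoly.
From mathcomp Require Import zify ring.

Set Implicit Arguments.
Unset Strict Implicit.
Unset Printing Implicit Defensive.

Import Order.TTheory GRing.Theory.

Local Open Scope classical_set_scope.
Local Open Scope ring_scope.

(** * Ideals *)

(** The existence of the Hilbert polynomial is itself proved here, from the same exact sequence. For
    a relevant prime p and each direction i, some variable of degree e_i lies outside p, so the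
    difference of the Hilbert function in direction i is the Hilbert function of a strictly larger
    ideal. Noetherian induction applies to that ideal, and the differences in all directions are
    then summed to one function. Working in the binomial basis also gives the final comparison: an
    eventually constant function has no coefficient but the constant one. Since subtraction in N^r
    truncates, degrees are shifted by addition wherever possible, and degrees not above that of a
    generator are treated apart. *)

Lemma ideal_ext (R : comNzRingType) (I I' : ideal R) :
  (forall x, I x <-> I' x) -> I = I'.
Proof.
move=> h; have e : ideal_set I = ideal_set I' by apply/funext => x; apply/propext.
case: I I' e {h} => [S a b c] [S' a' b' c'] /= e; subst S'.
by congr Ideal; exact: Prop_irrelevance.
Qed.

Section IdealTheory.
Variables (R : comNzRingType).
Implicit Types (I J K : ideal R).

Lemma idealN I x : I x -> I (- x).
Proof. by move=> h; rewrite -mulN1r; exact: idealM. Qed.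

Lemma idealB I x y : I x -> I y -> I (x - y).
Proof. by move=> h h'; apply: idealD => //; exact: idealN. Qed.

Lemma idealMr I a x : I x -> I (x * a).
Proof. by move=> h; rewrite mulrC; exact: idealM. Qed.

Lemma ideal_sum I (T : Type) (r : seq T) (P : pred T) (F : T -> R) :
  (forall i, P i -> I (F i)) -> I (\sum_(i <- r | P i) F i).
Proof.
by move=> h; elim/big_rec: _ => [|i x Pi Ix]; [exact: ideal0|apply: idealD => //; exact: h].
Qed.

Section Colon.
Variables (I : ideal R) (f : R).

Definition colon_set : R -> Prop := fun a => I (a * f).

Lemma colon0 : colon_set 0. Proof. by rewrite /colon_set mul0r; exact: ideal0. Qed.

Lemma colonD x y : colon_set x -> colon_set y -> colon_set (x + y).
Proof. by rewrite /colon_set mulrDl; exact: idealD. Qed.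

Lemma colonM a x : colon_set x -> colon_set (a * x).
Proof. by rewrite /colon_set -mulrA; exact: idealM. Qed.

Definition colon : ideal R := Ideal colon0 colonD colonM.
End Colon.

Lemma sub_colon I f : I `<=` colon I f.
Proof. by move=> x h; exact: idealMr. Qed.

Lemma addgens1P I f x : addgens I [:: f] x <-> exists u a, I u /\ x = u + a * f.
Proof.
split=> [[u [Iu [c ->]]]|[u [a [Iu ->]]]].
  by exists u, (c ord0); split=> //; rewrite big_ord1.
by exists u; split=> //; exists (fun=> a); rewrite big_ord1.
Qed.

Lemma sub_addgens I s : I `<=` addgens I s.
Proof.
by move=> x h; exists x; split=> //; exists (fun=> 0);
  rewrite big1 ?addr0 // => l _; rewrite mul0r.
Qed.

Lemma mem_addgens1 I f : addgens I [:: f] f.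
Proof. by apply/addgens1P; exists 0, 1; split; [exact: ideal0|rewrite add0r mul1r]. Qed.

Lemma addgens_nil I : addgens I [::] = I.
Proof.
apply: ideal_ext => x; split; last exact: sub_addgens.
by move=> [u [Iu [c ->]]]; rewrite big_ord0 addr0.
Qed.

Lemma addgens_cons I f s : addgens I (f :: s) = addgens (addgens I [:: f]) s.
Proof.
apply: ideal_ext => x; split.
  move=> [u [Iu [c ->]]]; rewrite big_ord_recl /= addrA.
  exists (u + c ord0 * f); split; first by apply/addgens1P; exists u, (c ord0).
  by exists (fun l => c (lift ord0 l)).
move=> [v [/addgens1P[u [a [Iu ->]]] [c ->]]]; exists u; split=> //.
exists (fun l => if unlift ord0 l is Some l' then c l' else a).
rewrite big_ord_recl /= unlift_none addrA; congr (_ + _).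
by apply: eq_bigr => l _; rewrite liftK.
Qed.

End IdealTheory.

(** * Noetherianity of polynomial rings *)

(** Past the last index chosen, pick one where [u] attains its minimum over all later indices;
    subsequent values cannot be smaller. *)
Lemma nondecreasing_subseq (u : nat -> nat) : exists phi : nat -> nat,
  (forall i, (phi i < phi i.+1)%N) /\
  forall i j, (i <= j)%N -> (u (phi i) <= u (phi j))%N.
Proof.
have min_after N : exists j, (N <= j)%N /\ forall j', (N <= j')%N -> (u j <= u j')%N.
  have ex : exists n, `[< exists2 j, (N <= j)%N & u j = n >].
    by exists (u N); apply/asboolP; exists N.
  case: (ex_minnP ex) => n /asboolP[j Nj <-] hmin; exists j; split=> // j' Nj'.
  by apply: hmin; apply/asboolP; exists j'.
have [a aP] := choice min_after.
pose phi := fix phi i := if i is i'.+1 then a (phi i').+1 else a 0%N.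
have phiS i : (phi i < phi i.+1)%N by have [] := aP (phi i).+1.
exists phi; split=> // i j.
have step l : (u (phi l) <= u (phi l.+1))%N.
  case: l => [|l]; apply: (aP _).2; first by [].
  by apply: ltnW; apply: leq_trans (phiS l.+1); rewrite ltnS; have [] := aP (phi l).+1.
elim: j => [|j IH]; first by rewrite leqn0 => /eqP->.
rewrite leq_eqVlt => /predU1P[->//|]; rewrite ltnS => /IH h.
exact: leq_trans h (step _).
Qed.

(** Dickson's lemma. Subsequences are extracted one coordinate at a time; the first two terms of the
    last one are comparable. *)
Lemma dickson_seq n (u : nat -> 'X_{1..n}) :
  exists i j, (i < j)%N /\ (u i <= u j)%MM.
Proof.
have sub c : exists phi : nat -> nat, (forall i, (phi i < phi i.+1)%N) /\
    forall l : 'I_n, (l < c)%N -> forall i j, (i <= j)%N -> (u (phi i) l <= u (phi j) l)%N.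
  elim: c => [|c [phi [phiS phiP]]]; first by exists id.
  have [cn|nc] := ltnP c n; last first.
    by exists phi; split=> // l _; apply: phiP; apply: leq_trans nc.
  have [psi [psiS psiP]] := nondecreasing_subseq (fun i => u (phi i) (Ordinal cn)).
  have homo f : (forall i, (f i < f i.+1)%N) -> forall i j, (i <= j)%N -> (f i <= f j)%N.
    move=> fS i; elim=> [|j IH]; first by rewrite leqn0 => /eqP->.
    rewrite leq_eqVlt => /predU1P[->//|]; rewrite ltnS => /IH h.
    by apply: leq_trans h _; exact: ltnW.
  exists (phi \o psi); split=> [i|l] /=.
    by apply: leq_trans (phiS _) _; exact: homo.
  rewrite ltnS leq_eqVlt => /predU1P[lc|lc] i j ij.
    by rewrite (_ : l = Ordinal cn); [exact: psiP|exact: val_inj].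
  by apply: phiP => //; exact: homo.
have [phi [phiS phiP]] := sub n; exists (phi 0%N), (phi 1%N); split=> //.
by apply/mnm_lepP => l; exact: phiP.
Qed.

Section Noetherian.
Variables (k : fieldType) (N : nat).
Local Notation A := {mpoly k[N]}.
Implicit Types (I J : ideal A).

Definition lead_monomial I (m : 'X_{1..N}) := exists f, [/\ I f, f != 0 & mlead f = m].

(** Reduction as with a Groebner basis: an element of [I] with the same leading monomial cancels the
    leading term of [f], and induction on the leading monomial does the rest. *)
Lemma eq_lead_sub I J : I `<=` J ->
  (forall m, lead_monomial J m -> lead_monomial I m) -> J `<=` I.
Proof.
move=> IJ h; apply: mleadrect => f IH Jf.
have [->|f0] := eqVneq f 0; first exact: ideal0.
have [|g [Ig g0 gf]] := h (mlead f); first by exists f.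
pose c := mleadc f / mleadc g.
have c0 : c * mleadc g != 0 by rewrite /c divfK ?mleadc_eq0.
have lcg : mlead (c *: g) = mlead f by rewrite mleadZ_proper.
have cg : (c *: g)@_(mlead f) = mleadc f.
  by rewrite mcoeffZ -{1}gf /c divfK // mleadc_eq0.
have Icg : I (c *: g) by rewrite -mul_mpolyC; exact: idealM.
rewrite -[f](subrK (c *: g)); apply: idealD => //.
have [->|fg0] := eqVneq (f - c *: g) 0; first exact: ideal0.
apply: IH; last by apply: idealB => //; exact: IJ.
rewrite lt_neqAle; apply/andP; split; last first.
  by have := mleadB_le f (c *: g); rewrite lcg joinxx.
apply/eqP => e; move: fg0; rewrite -mleadc_eq0 e mcoeffB.
by rewrite cg subrr eqxx.
Qed.

(* An ascending chain yields leading monomials each new at its step, against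
   Dickson's lemma. *)
Lemma noetherian (F : nat -> ideal A) :
  ~ forall i, F i `<=` F i.+1 /\ ~ (F i.+1 `<=` F i).
Proof.
move=> h.
have mono i j : (i <= j)%N -> F i `<=` F j.
  elim: j => [|j IH]; first by rewrite leqn0 => /eqP->.
  rewrite leq_eqVlt => /predU1P[->//|]; rewrite ltnS => /IH ij.
  by apply: subset_trans ij _; have [] := h j.
have new i : exists f, [/\ F i.+1 f, f != 0 & ~ lead_monomial (F i) (mlead f)].
  have [hi ni] := h i; apply: contrapT => no; apply: ni; apply: eq_lead_sub => // m.
  move=> [f [Ff f0 <-]]; apply: contrapT => nl; apply: no; by exists f.
have [f fP] := choice new.
have [i [j [ij le_ij]]] := dickson_seq (fun i => mlead (f i)).
have [_ f0 []] := fP j; have [Fi fi0 _] := fP i.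
exists ('X_[mlead (f j) - mlead (f i)] * f i); split.
- by apply: idealM; exact: mono Fi.
- by rewrite mulf_neq0 // -msupp_eq0 msuppX.
- rewrite mleadM ?mleadXm ?submK //.
  by rewrite -msupp_eq0 msuppX.
Qed.

Lemma exists_maximal (P : ideal A -> Prop) I : P I -> exists J,
  [/\ P J, I `<=` J & forall J', P J' -> J `<=` J' -> J' `<=` J].
Proof.
move=> PI; apply: contrapT => no.
pose T := {J : ideal A | P J /\ I `<=` J}.
have next (J : T) : exists J' : T, sval J `<=` sval J' /\ ~ (sval J' `<=` sval J).
  case: J => J /= [PJ IJ]; apply: contrapT => no'; apply: no; exists J; split=> // J' PJ' JJ'.
  apply: contrapT => nJ; apply: no'.
  by exists (exist _ J' (conj PJ' (subset_trans IJ JJ'))).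
have [g gP] := choice next.
pose F i : T := iter i g (exist _ I (conj PI (@subset_refl _ I))).
by apply: (@noetherian (fun i => sval (F i))) => i; exact: gP.
Qed.

Lemma noetherian_ind (P : ideal A -> Prop) :
  (forall I, (forall J, I `<=` J -> ~ (J `<=` I) -> P J) -> P I) -> forall I, P I.
Proof.
move=> h I; apply: contrapT => nI.
have [J [nJ _ Jmax]] := @exists_maximal (fun I => ~ P I) I nI.
apply: nJ; apply: h => J' JJ' nJ'; apply: contrapT => nPJ'.
by apply: nJ'; exact: Jmax.
Qed.

End Noetherian.

(** * Homogeneous components and graded ideals *)

Section Graded.
Variables (k : fieldType) (r : nat) (d : 'I_r -> nat).
Local Notation A := (multiring k d).
Implicit Types (nu mu : 'X_{1..r}) (f g : A) (I J K p q : ideal A).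

Lemma homogeneousP nu f :
  homogeneous nu f <-> forall m, f@_m != 0 -> multideg m = nu.
Proof. by split=> h m; [rewrite -mcoeff_msupp|rewrite mcoeff_msupp]; exact: h. Qed.

Lemma homogeneousD nu f g :
  homogeneous nu f -> homogeneous nu g -> homogeneous nu (f + g).
Proof. by move=> hf hg m /msuppD_le; rewrite mem_cat => /orP[/hf|/hg]. Qed.

Lemma homogeneousN nu f : homogeneous nu f -> homogeneous nu (- f).
Proof. by move=> hf m; rewrite (perm_mem (msuppN f)); exact: hf. Qed.

Lemma homogeneous0 nu : homogeneous nu (0 : A).
Proof. by move=> m; rewrite msupp0. Qed.

Lemma homogeneousCM nu c f : homogeneous nu f -> homogeneous nu (c%:MP * f).
Proof. by move=> hf; rewrite -[nu]add0m; apply: homogM hf; exact: homogC. Qed.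

Lemma homogeneous_sum nu (T : Type) (s : seq T) (P : pred T) (F : T -> A) :
  (forall i, P i -> homogeneous nu (F i)) -> homogeneous nu (\sum_(i <- s | P i) F i).
Proof.
move=> h; elim/big_rec: _ => [|i x Pi hx]; first exact: homogeneous0.
by apply: homogeneousD => //; exact: h.
Qed.

Lemma homogeneousX m : homogeneous (multideg m) ('X_[m] : A).
Proof. by move=> m'; rewrite msuppX inE => /eqP->. Qed.

Lemma mcoeff_hcomp nu f m :
  (hcomp nu f)@_m = if multideg m == nu then f@_m else 0.
Proof.
rewrite /hcomp raddf_sum /=.
under eq_bigr do rewrite mcoeffZ mcoeffX.
have [mf|mf] := boolP (m \in msupp f); last first.
  rewrite big_seq_cond big1 ?(memN_msupp_eq0 mf) ?if_same // => m' /andP[m'f _].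
  by case: eqP mf => [<-|]; rewrite ?m'f ?mulr0.
rewrite big_mkcond (bigD1_seq m) //= ?msupp_uniq // eqxx mulr1 big1 ?addr0 //.
by move=> m' /negPf m'm; rewrite m'm mulr0 if_same.
Qed.

Lemma homogeneous_hcomp nu f : homogeneous nu (hcomp nu f).
Proof.
by apply/homogeneousP => m; rewrite mcoeff_hcomp; case: (multideg m =P nu); rewrite ?eqxx.
Qed.

Arguments homogeneous_hcomp : clear implicits.

Lemma hcomp_homogeneous nu mu f :
  homogeneous mu f -> hcomp nu f = if mu == nu then f else 0.
Proof.
move=> /homogeneousP hf; apply/mpolyP => m; rewrite mcoeff_hcomp.
have [f0|/hf<-] := eqVneq f@_m 0; last by case: eqP; rewrite ?mcoeff0.
by rewrite f0 if_same; case: eqP; rewrite ?mcoeff0 ?f0.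
Qed.

Lemma hcompD nu f g : hcomp nu (f + g) = hcomp nu f + hcomp nu g.
Proof.
by apply/mpolyP => m; rewrite mcoeffD !mcoeff_hcomp mcoeffD; case: eqP; rewrite ?addr0.
Qed.

Lemma hcomp0 nu : hcomp nu (0 : A) = 0.
Proof. by apply/mpolyP => m; rewrite mcoeff_hcomp mcoeff0 if_same. Qed.

Lemma hcomp_sum nu (T : Type) (s : seq T) (P : pred T) (F : T -> A) :
  hcomp nu (\sum_(i <- s | P i) F i) = \sum_(i <- s | P i) hcomp nu (F i).
Proof. exact: (big_morph _ (hcompD nu) (hcomp0 nu)). Qed.

Definition degrees f : seq 'X_{1..r} := undup [seq multideg m | m <- msupp f].

Lemma sum_hcomp f : f = \sum_(nu <- degrees f) hcomp nu f.
Proof.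
apply/mpolyP => m; rewrite raddf_sum /=.
under eq_bigr do rewrite mcoeff_hcomp.
have [mf|mf] := boolP (m \in msupp f); last first.
  by rewrite big1 ?memN_msupp_eq0 // => nu _; rewrite if_same.
rewrite (bigD1_seq (multideg m)) /= ?undup_uniq ?mem_undup ?map_f // eqxx.
by rewrite big1 ?addr0 // => nu /negPf; rewrite eq_sym => ->.
Qed.

Lemma hcomp_mulr nu mu f g : homogeneous mu g ->
  hcomp (nu + mu)%MM (f * g) = hcomp nu f * g.
Proof.
move=> hg; rewrite {1}[f]sum_hcomp mulr_suml hcomp_sum.
transitivity (\sum_(t <- degrees f) (if t == nu then hcomp nu f * g else 0)).
  apply: eq_bigr => t _.
  rewrite (hcomp_homogeneous _ (homogM (homogeneous_hcomp t f) hg)) eqm_add2r.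
  by case: eqP => // ->.
have [nf|nf] := boolP (nu \in degrees f).
  by rewrite (bigD1_seq nu) ?undup_uniq //= eqxx big1 ?addr0 // => t /negPf->.
rewrite big_seq big1; last by move=> t tf; case: eqP nf => [<-|//]; rewrite tf.
suff -> : hcomp nu f = 0 by rewrite mul0r.
apply/mpolyP => m; rewrite mcoeff_hcomp mcoeff0; case: eqP => // e.
apply: memN_msupp_eq0; apply: contra nf => mf.
by rewrite mem_undup -e map_f.
Qed.

(** Complement of [hcomp_mulr] for the degrees that cannot be written as a sum with [mu]. *)
Lemma hcomp_mulr0 nu mu f g : homogeneous mu g -> ~~ (mu <= nu)%MM ->
  hcomp nu (f * g) = 0.
Proof.
move=> hg n; rewrite [f]sum_hcomp mulr_suml hcomp_sum big1 // => t _.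
rewrite (hcomp_homogeneous _ (homogM (homogeneous_hcomp t f) hg)).
by case: eqP n => // <-; rewrite lem_addl.
Qed.

Lemma mem_hcomp I f : (forall nu, I (hcomp nu f)) -> I f.
Proof. by move=> h; rewrite [f]sum_hcomp; exact: ideal_sum. Qed.

Lemma sub_homogeneous I J : graded_ideal I ->
  (forall nu f, homogeneous nu f -> I f -> J f) -> I `<=` J.
Proof.
move=> gI h f If; apply: mem_hcomp => nu.
by apply: (h nu); [exact: homogeneous_hcomp|exact: gI].
Qed.

Lemma exists_homogeneous_notin I J : graded_ideal I -> ~ (I `<=` J) ->
  exists nu f, [/\ homogeneous nu f, I f & ~ J f].
Proof.
move=> gI IJ; apply: contrapT => no; apply: IJ; apply: sub_homogeneous => // nu f hf If.
by apply: contrapT => nJ; apply: no; exists nu, f.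
Qed.

Lemma graded_colon I mu g : graded_ideal I -> homogeneous mu g ->
  graded_ideal (colon I g).
Proof. by move=> gI hg f nu If; rewrite /= /colon_set -(hcomp_mulr _ _ hg); exact: gI. Qed.

Lemma graded_addgens1 I mu g : graded_ideal I -> homogeneous mu g ->
  graded_ideal (addgens I [:: g]).
Proof.
move=> gI hg f nu /addgens1P[u [a [Iu ->]]]; rewrite hcompD; apply/addgens1P.
have [le|nle] := boolP (mu <= nu)%MM.
  exists (hcomp nu u), (hcomp (nu - mu)%MM a); split; first exact: gI.
  by rewrite -(hcomp_mulr _ _ hg) submK.
by exists (hcomp nu u), 0; rewrite (hcomp_mulr0 _ hg) // mul0r; split=> //; exact: gI.
Qed.

(** Taking components makes both the remainder and the cofactor of [g] homogeneous. The left
    alternative covers degrees [nu] not above [mu], where no multiple of [g] contributes. *)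
Lemma addgens1_homogeneous I mu g nu f : graded_ideal I -> homogeneous mu g ->
    homogeneous nu f -> addgens I [:: g] f -> I f \/
  exists u a t, [/\ I u, homogeneous t a, homogeneous nu u, nu = (t + mu)%MM & f = u + a * g].
Proof.
move=> gI hg hf /addgens1P[u [a [Iu e]]].
have {}e : f = hcomp nu u + hcomp nu (a * g).
  by rewrite -hcompD -e (hcomp_homogeneous _ hf) eqxx.
have [le|nle] := boolP (mu <= nu)%MM; last first.
  by left; rewrite e (hcomp_mulr0 _ hg) // addr0; exact: gI.
right; exists (hcomp nu u), (hcomp (nu - mu)%MM a), (nu - mu)%MM; split.
- exact: gI.
- exact: homogeneous_hcomp.
- exact: homogeneous_hcomp.
- by rewrite submK.
- by rewrite {1}e -(hcomp_mulr _ _ hg) submK.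
Qed.

Lemma exists_max_mnm (s : seq 'X_{1..r}) : s != [::] ->
  exists2 nu, nu \in s & forall mu, mu \in s -> (mu <= nu)%O.
Proof.
elim: s => // a [|b s] IH _; first by exists a; rewrite ?mem_head // => mu; rewrite inE => /eqP->.
have [//|nu ns nmax] := IH; have [le|lt] := leP nu a.
  exists a; rewrite ?mem_head // => mu; rewrite inE => /predU1P[->//|/nmax h].
  exact: le_trans le.
exists nu; first by rewrite inE ns orbT.
by move=> mu; rewrite inE => /predU1P[->|/nmax//]; exact: ltW.
Qed.

(* If f, g lie outside I, drop their components in I; the product of the two
   top components left is the top component of fg. *)
Lemma homogeneous_prime I : graded_ideal I -> ~ I 1 ->
  (forall nu mu f g, homogeneous nu f -> homogeneous mu g -> I (f * g) -> I f \/ I g) ->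
  prime_ideal I.
Proof.
move=> gI nI1 hp; split=> // f g Ifg; apply: contrapT => /not_orP[If Ig].
pose S f := [seq nu <- degrees f | `[< ~ I (hcomp nu f) >]].
pose t f := \sum_(nu <- S f) hcomp nu f.
have It h : I (h - t h).
  rewrite {1}[h]sum_hcomp /t big_filter [X in _ - X]big_mkcond -sumrB /=.
  apply: ideal_sum => nu _; case: asboolP => [_|/contrapT]; first by rewrite subrr; exact: ideal0.
  by rewrite subr0.
have S0 h : ~ I h -> S h != [::].
  move=> nIh; apply/eqP => e; apply: nIh; rewrite -[h](subrK (t h)).
  by apply: idealD => //; rewrite /t e big_nil; exact: ideal0.
have [nu nuS numax] := exists_max_mnm (S0 _ If).
have [mu muS mumax] := exists_max_mnm (S0 _ Ig).
have Itt : I (t f * t g).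
  rewrite (_ : t f * t g = f * g - ((f - t f) * g + t f * (g - t g))); last by ring.
  by apply: idealB => //; apply: idealD; [exact: idealMr|exact: idealM].
have /(gI _ (nu + mu)%MM) : I (t f * t g) by [].
rewrite /t mulr_suml hcomp_sum.
under eq_bigr do rewrite mulr_sumr hcomp_sum.
have uS h : uniq (S h) by rewrite filter_uniq // undup_uniq.
rewrite (bigD1_seq nu) //= (bigD1_seq mu) //= !big1_seq ?addr0.
- rewrite (hcomp_homogeneous _ (homogM (homogeneous_hcomp nu f) (homogeneous_hcomp mu g))) eqxx.
  move=> /(hp nu mu _ _ (homogeneous_hcomp _ _) (homogeneous_hcomp _ _)) [h|h].
    by move: nuS; rewrite mem_filter => /andP[/asboolP].
  by move: muS; rewrite mem_filter => /andP[/asboolP].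
- move=> n1 /andP[n1nu n1S]; rewrite big1_seq // => m1 /andP[_ m1S].
  rewrite (hcomp_homogeneous _ (homogM (homogeneous_hcomp n1 f) (homogeneous_hcomp m1 g))).
  case: eqP => // e; have : ((n1 + m1)%MM < (nu + mu)%MM)%O.
    by apply: ltmc_le_add; [rewrite lt_neqAle n1nu numax|exact: mumax].
  by rewrite e ltxx.
- move=> m1 /andP[m1mu m1S].
  rewrite (hcomp_homogeneous _ (homogM (homogeneous_hcomp nu f) (homogeneous_hcomp m1 g))).
  by rewrite eqm_add2l (negPf m1mu).
Qed.

(** Writing large degrees as [nu0 + nu] replaces inequalities between exponents by additions. *)
Definition eventually (P : 'X_{1..r} -> Prop) := exists nu0, forall nu, P (nu0 + nu)%MM.

Lemma eventually_and (P Q : 'X_{1..r} -> Prop) :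
  eventually P -> eventually Q -> eventually (fun nu => P nu /\ Q nu).
Proof.
move=> [a ha] [b hb]; exists (a + b)%MM => nu; split; first by rewrite -addmA.
by rewrite [(a + b)%MM]addmC -addmA.
Qed.

Lemma eventually_imp (P Q : 'X_{1..r} -> Prop) :
  (forall nu, P nu -> Q nu) -> eventually P -> eventually Q.
Proof. by move=> h [a ha]; exists a => nu; exact: h. Qed.

Lemma eventually_shift mu (P : 'X_{1..r} -> Prop) :
  eventually P -> eventually (fun nu => P (nu + mu)%MM).
Proof. by move=> [a ha]; exists a => nu; rewrite -addmA. Qed.

(** Quantifying over [t] avoids the truncated [nu - mu] and matches the degree equation delivered by
    [addgens1_homogeneous]. *)
Lemma eventually_unshift mu (P : 'X_{1..r} -> Prop) :
  eventually P -> eventually (fun nu => forall t, nu = (t + mu)%MM -> P t).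
Proof.
move=> [a ha]; exists (a + mu)%MM => nu t e.
have -> : t = (a + nu)%MM by apply: (@addIm _ mu); rewrite -e -!addmA [(mu + _)%MM]addmC.
exact: ha.
Qed.

Lemma eventually_forall (T : finType) (P : T -> 'X_{1..r} -> Prop) :
  (forall i, eventually (P i)) -> eventually (fun nu => forall i, P i nu).
Proof.
move=> /choice[a aP]; exists (\sum_i a i)%MM => nu i.
by rewrite (bigD1 i) //= -addmA; exact: aP.
Qed.

Definition full_in I nu := forall f : A, homogeneous nu f -> I f.

Definition relevant I := ~ (@irrelevant k r d `<=` I).

Lemma irrelevant_full I : ~ relevant I -> eventually (full_in I).
Proof.
move=> /contrapT NI; exists [multinom 1%N | i < r] => nu f hf; apply: NI => m /hf -> i.
by rewrite mnmDE mnmE.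
Qed.

Lemma multidegE m i : multideg (d := d) m i = (\sum_(l | tag (enum_val l) == i) m l)%N.
Proof.
rewrite /multideg mnm_sumE [RHS]big_mkcond /=; apply: eq_bigr => l _.
by rewrite mulmnE mnm1E; case: eqP; rewrite ?mul1n ?mul0n.
Qed.

(** The variables of the i-th group generate an ideal containing the irrelevant one, so a relevant
    ideal misses one of them. *)
Lemma relevant_var p i : relevant p -> exists2 t, homogeneous U_(i)%MM t & ~ p t.
Proof.
move=> rp; apply: contrapT => no; apply: rp => f Nf; rewrite [f]mpolyE.
rewrite big_seq; apply: ideal_sum => m /Nf /(_ i); rewrite multidegE lt0n => m0.
have [l /eqP li ml] : exists2 l, tag (enum_val l) == i & (0 < m l)%N.
  apply: contrapT => h; move/eqP: m0; apply; apply: big1 => l li.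
  by apply/eqP; rewrite -leqn0 leqNgt; apply/negP => ml; apply: h; exists l.
have -> : m = (m - U_(l) + U_(l))%MM by rewrite submK // lep1mP -lt0n.
rewrite mpolyXD scalerAl; apply: idealM; apply: contrapT => nl; apply: no.
exists 'X_l => //; rewrite -li.
have -> : U_(tag (enum_val l))%MM = multideg U_(l)%MM; last exact: homogeneousX.
apply/mnmP => j; rewrite multidegE mnm1E.
under eq_bigr do rewrite mnm1E.
rewrite big_mkcond (bigD1 l) //= eqxx big1 ?addn0; first by case: eqP.
by move=> l' /negPf; rewrite eq_sym => ->; rewrite if_same.
Qed.

(** A product of powers of such variables. It supplies denominators of any prescribed degree at a
    point. *)
Lemma relevant_homogeneous p nu : prime_ideal p -> relevant p ->
  exists2 t, homogeneous nu t & ~ p t.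
Proof.
move=> [p1 pM] rp; rewrite [nu]multinomUE_id; elim/big_rec: _ => [|i mu _ [t ht pt]].
  by exists 1 => //; exact: homogC.
have [x hx px] := relevant_var i rp.
exists (x ^+ nu i * t); last first.
  move=> /pM [] //; elim: (nu i) => [|m IH]; first by rewrite expr0.
  by rewrite exprS => /pM [].
apply: homogM => //; elim: (nu i) => [|m IH]; first by rewrite expr0; exact: homogC.
by rewrite exprS mulmS; exact: homogM.
Qed.

End Graded.
Arguments homogeneous_hcomp {k r d} nu f _ _.
Arguments homogeneousX {k r d} m _ _.

(** * Hilbert functions *)

Section HilbertFunction.
Variables (k : fieldType) (r : nat) (d : 'I_r -> nat).
Local Notation A := (multiring k d).
Implicit Types (nu mu : 'X_{1..r}) (f g : A) (I J K p q : ideal A).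

Section Families.
Variables (T : finType) (b : T -> A).

Definition comb (c : T -> k) : A := \sum_t (c t)%:MP * b t.

Lemma combD c c' : comb (fun t => c t + c' t) = comb c + comb c'.
Proof. by rewrite -big_split /=; apply: eq_bigr => t _; rewrite mpolyCD mulrDl. Qed.

Lemma combM a c : comb (fun t => a * c t) = a%:MP * comb c.
Proof. by rewrite mulr_sumr; apply: eq_bigr => t _; rewrite mpolyCM mulrA. Qed.

Lemma comb0 : comb (fun=> 0) = 0.
Proof. by rewrite /comb big1 // => t _; rewrite mpolyC0 mul0r. Qed.

Lemma homogeneous_comb nu c : (forall t, homogeneous nu (b t)) -> homogeneous nu (comb c).
Proof. by move=> h; apply: homogeneous_sum => t _; apply: homogeneousCM; exact: h. Qed.

Definition spanned I u := exists c, I (u - comb c).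

Definition independent I := forall c, I (comb c) -> forall t, c t = 0.

Lemma spannedD I u v : spanned I u -> spanned I v -> spanned I (u + v).
Proof.
move=> [c Ic] [c' Ic']; exists (fun t => c t + c' t).
by rewrite combD opprD addrACA; exact: idealD.
Qed.

Lemma spannedM I a u : spanned I u -> spanned I (a%:MP * u).
Proof.
by move=> [c Ic]; exists (fun t => a * c t); rewrite combM -mulrBr; exact: idealM.
Qed.

Lemma spanned0 I : spanned I 0.
Proof. by exists (fun=> 0); rewrite comb0 subr0; exact: ideal0. Qed.

End Families.

(** An arbitrary finite index type lets bases be enlarged or joined through sum types; [hbasisP]
    returns to the ordinals of [quot_dim]. *)
Definition hbasis I nu (T : finType) (b : T -> A) :=
  [/\ forall t, homogeneous nu (b t), forall u, homogeneous nu u -> spanned b I u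
    & independent b I].

Lemma hbasis_ord I nu (T : finType) (b : T -> A) : hbasis I nu b ->
  hbasis I nu (fun i : 'I_#|T| => b (enum_val i)).
Proof.
have e c : comb (fun i : 'I_#|T| => b (enum_val i)) c = comb b (c \o enum_rank).
  rewrite /comb [RHS](reindex (@enum_val T T)) /=.
    by apply: eq_bigr => i _; rewrite enum_valK.
  exact: onW_bij (enum_val_bij T).
move=> [hb sb ib]; split=> [i|u /sb[c Ic]|c]; first exact: hb.
  exists (c \o enum_val); rewrite e (_ : (c \o _) \o _ = c) //.
  by apply/funext => t /=; rewrite enum_rankK.
by rewrite e => /ib h i; rewrite -(enum_valK i); exact: h.
Qed.

Lemma hbasisP I nu n : hilbert_function I nu n <-> exists b : 'I_n -> A, hbasis I nu b.
Proof.
split=> [[b [hb bP]]|[b [hb sb ib]]]; exists b; last first.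
  split=> // u hu; have [c Ic] := sb u hu.
  have ce : \sum_i ([ffun i => c i] i)%:MP * b i = comb b c.
    by apply: eq_bigr => i _; rewrite ffunE.
  exists [ffun i => c i]; split=> [|c' [Ic' _]].
    by rewrite ce; split=> //; apply: homogB => //; exact: homogeneous_comb.
  apply/ffunP => i; rewrite ffunE; apply/eqP; rewrite -subr_eq0; apply/eqP.
  move: i; apply: (ib (fun i => c i - c' i)).
  have -> : comb b (fun i => c i - c' i) = comb b c - comb b c'.
    rewrite -[- _]mulN1r -mpolyC1 -mpolyCN -combM -combD; congr comb.
    by apply/funext => i; rewrite mulN1r.
  rewrite (_ : _ - _ = (u - comb b c') - (u - comb b c)); last by ring.
  exact: idealB.
split=> // [u /bP[c [[Ic _] _]]|c Ic i]; first by exists c.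
(* Independence is the uniqueness of the expansion of 0: both [c] and the zero family expand it
   modulo [I]. *)
have [c0 [_ uniq0]] := bP 0 (@homogeneous0 _ _ _ nu).
have <- : c0 i = 0.
  have -> : c0 = [ffun=> 0]; last by rewrite ffunE.
  apply: uniq0; split; last apply: homogB; first 1 last.
  - exact: homogeneous0.
  - by apply: homogeneous_sum => j _; apply: homogeneousCM.
  - rewrite sub0r; apply: idealN; rewrite big1 => [|j _]; first exact: ideal0.
    by rewrite ffunE mpolyC0 mul0r.
have -> : c0 = [ffun i => c i]; last by rewrite ffunE.
have ce : \sum_i ([ffun i => c i] i)%:MP * b i = comb b c.
  by apply: eq_bigr => j _; rewrite ffunE.
apply: uniq0; rewrite ce sub0r; split; first exact: idealN.
by apply: homogeneousN; exact: homogeneous_comb.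
Qed.

Lemma mdeg_multideg m : mdeg (multideg (d := d) m) = mdeg m.
Proof.
rewrite /multideg mdeg_sum [RHS]mdegE; apply: eq_bigr => l _.
by rewrite mdegMn mdeg1 mul1n.
Qed.

(** Run through the monomials of degree [nu], keeping those not yet spanned modulo [I]. They are
    finitely many because [multideg] preserves the total degree. *)
Lemma hbasis_exists I nu : exists (T : finType) (b : T -> A), hbasis I nu b.
Proof.
have ext (s : seq A) : (forall v, v \in s -> homogeneous nu v) ->
    exists (T : finType) (b : T -> A), [/\ forall t, homogeneous nu (b t),
      forall u, u \in s -> spanned b I u & independent b I].
  elim: s => [|v s IH] hs.
    by exists 'I_0, (fun=> 0); split=> [||c _] [].
  have [|T [b [hb sb ib]]] := IH; first by move=> u us; apply: hs; rewrite inE us orbT.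
  have [sv|nv] := pselect (spanned b I v).
    by exists T, b; split=> // u; rewrite inE => /predU1P[->|/sb].
  pose b' (t : 'I_1 + T) := if t is inr t' then b t' else v.
  have e c : comb b' c = (c (inl ord0))%:MP * v + comb b (c \o inr).
    by rewrite /comb big_sumType /= big_ord1.
  exists ('I_1 + T)%type, b'; split=> [[t|t]|u|c].
  - by apply: hs; rewrite mem_head.
  - exact: hb.
  - rewrite inE => /predU1P[->|/sb[c Ic]].
      exists (fun t => if t is inl _ then 1 else 0); rewrite e mpolyC1 mul1r.
      by rewrite opprD addNKr (comb0 b) oppr0; exact: ideal0.
    exists (fun t => if t is inr t' then c t' else 0).
    by rewrite e mpolyC0 mul0r add0r.
  rewrite e => Ic; have c0 : c (inl ord0) = 0.
    apply: contrapT => /eqP c0; apply: nv; exists (fun t => - (c (inl ord0))^-1 * c (inr t)).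
    rewrite combM mpolyCN mulNr opprK.
    rewrite (_ : v = ((c (inl ord0))^-1)%:MP * ((c (inl ord0))%:MP * v)).
      by rewrite -mulrDr; exact: idealM.
    by rewrite mulrA -mpolyCM mulVf // mpolyC1 mul1r.
  move: Ic; rewrite c0 mpolyC0 mul0r add0r => /ib h [t|t]; last exact: h.
  by rewrite ord1.
pose s := [seq 'X_[bmnm m] : A | m <- enum {: 'X_{1..(nvars d) < (mdeg nu).+1}}
                               & multideg (bmnm m) == nu].
have [|T [b [hb sb ib]]] := ext s.
  move=> v /mapP[m]; rewrite mem_filter => /andP[/eqP e _] ->; by move=> m' /homogeneousX->.
exists T, b; split=> // u hu; rewrite [u]mpolyE big_seq.
apply: (big_ind (spanned b I)) => [||m mu]; first exact: spanned0.
  by move=> *; exact: spannedD.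
rewrite -mul_mpolyC; apply: spannedM; apply: sb.
have lt : (mdeg m < (mdeg nu).+1)%N by rewrite -(hu m mu) mdeg_multideg.
by apply/mapP; exists (BMultinom lt) => //; rewrite mem_filter /= (hu m mu) eqxx mem_enum.
Qed.

(** The coordinates of [b'] in the basis [b] form the rows of a matrix; a vector in its left kernel
    would be a relation between the [b'] modulo [I]. *)
Lemma independent_leq I nu n n' (b : 'I_n -> A) (b' : 'I_n' -> A) :
  hbasis I nu b -> (forall i, homogeneous nu (b' i)) -> independent b' I -> (n' <= n)%N.
Proof.
move=> [_ sb _] hb' ib'.
have /choice[M MP] : forall i, exists c, I (b' i - comb b c) by move=> i; exact: sb.
pose B := \matrix_(i < n', j < n) M i j.
suff : row_free B by rewrite /row_free => /eqP<-; exact: rank_leq_col.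
apply: inj_row_free => v /rowP vB; apply/rowP => i; rewrite mxE.
move: i; apply: (ib' (fun i => v 0 i)).
rewrite (_ : comb b' _ = \sum_i (v 0 i)%:MP * (b' i - comb b (M i))).
  by apply: ideal_sum => i _; exact: idealM.
under [RHS]eq_bigr do rewrite mulrBr.
rewrite sumrB -[LHS]subr0; congr (_ - _); apply/esym.
under eq_bigr do rewrite mulr_sumr.
rewrite exchange_big /= big1 // => j _.
under eq_bigr do rewrite mulrA -mpolyCM.
rewrite -mulr_suml -raddf_sum /=.
have := vB j; rewrite !mxE => e; rewrite (_ : \sum_(i < n') _ = 0) ?mpolyC0 ?mul0r //.
by rewrite -[RHS]e; apply: eq_bigr => i _; rewrite mxE.
Qed.

Lemma hilbert_function_exists I nu : exists n, hilbert_function I nu n.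
Proof.
have [T [b hb]] := hbasis_exists I nu; exists #|T|.
by apply/hbasisP; exists (b \o enum_val); exact: hbasis_ord hb.
Qed.

Definition hilb I nu : nat := sval (cid (hilbert_function_exists I nu)).

Lemma hilbP I nu : hilbert_function I nu (hilb I nu).
Proof. by rewrite /hilb; case: cid. Qed.

Lemma hilbE I nu (T : finType) (b : T -> A) : hbasis I nu b -> hilb I nu = #|T|.
Proof.
move=> /hbasis_ord hb; have [b' hb'] := (hbasisP _ _ _).1 (hilbP I nu).
have [h _ i] := hb; have [h' _ i'] := hb'.
by apply/eqP; rewrite eqn_leq (independent_leq hb h' i') (independent_leq hb' h i).
Qed.

Lemma hilb_basis I nu : exists b : 'I_(hilb I nu) -> A, hbasis I nu b.
Proof. by apply/hbasisP; exact: hilbP. Qed.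

Lemma eq_hilb I J nu : (forall f, homogeneous nu f -> I f <-> J f) -> hilb I nu = hilb J nu.
Proof.
move=> h; have [b [hb sb ib]] := hilb_basis I nu.
rewrite -[LHS]card_ord; apply/esym; apply: (hilbE (b := b)); split=> // [u hu|c Jc].
  have [c Ic] := sb u hu; exists c; apply/h => //.
  by apply: homogB => //; exact: homogeneous_comb.
by apply: ib; apply/h => //; exact: homogeneous_comb.
Qed.

Lemma hilb_full I nu : full_in I nu <-> hilb I nu = 0%N.
Proof.
split=> [h|h0 u hu].
  rewrite -(card_ord 0); apply: (@hilbE I nu 'I_0 (fun=> 0)); split=> [[]//|u hu|c _ []//].
  by exists (fun=> 0); rewrite /comb big_ord0 subr0; exact: h.
have [b [_ sb _]] := hilb_basis I nu; have [c] := sb u hu.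
by rewrite /comb big1 ?subr0 // => i; have := ltn_ord i; rewrite [X in (_ < X)%N]h0.
Qed.

(* The exact sequence is 0 -> (A/(I : f))(-mu) -> A/I -> A/(I + (f)) -> 0. *)
Lemma hilb_addgens1 I nu mu f : graded_ideal I -> homogeneous mu f ->
  hilb I (nu + mu)%MM = (hilb (addgens I [:: f]) (nu + mu)%MM + hilb (colon I f) nu)%N.
Proof.
move=> gI hf; have [b [hb sb ib]] := hilb_basis (addgens I [:: f]) (nu + mu)%MM.
have [b' [hb' sb' ib']] := hilb_basis (colon I f) nu.
pose b2 (t : 'I_(hilb (addgens I [:: f]) (nu + mu)%MM) + 'I_(hilb (colon I f) nu)) :=
  match t with inl i => b i | inr j => b' j * f end.
have e c : comb b2 c = comb b (c \o inl) + comb b' (c \o inr) * f.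
  rewrite {1}/comb big_sumType /=; congr (_ + _).
  by rewrite mulr_suml; apply: eq_bigr => j _; rewrite /= mulrA.
suff hb2 : hbasis I (nu + mu)%MM b2 by rewrite (hilbE hb2) card_sum !card_ord.
split=> [[i|j]|u hu|c].
- exact: hb.
- by apply: homogM.
- have [c Ic] := sb u hu.
  have hu' : homogeneous (nu + mu)%MM (u - comb b c).
    by apply: homogB => //; exact: homogeneous_comb.
  have [Iu|[v [a [t [Iv ha _ et euv]]]]] := addgens1_homogeneous gI hf hu' Ic.
    exists (fun t => if t is inl i then c i else 0); rewrite e.
    by rewrite (comb0 b') mul0r addr0.
  have tnu : t = nu by apply: (@addIm _ mu).
  rewrite tnu in ha; have [c' Ic'] := sb' a ha.
  exists (fun t => match t with inl i => c i | inr j => c' j end); rewrite e.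
  rewrite opprD addrA euv -addrA -mulrBl; exact: idealD.
- rewrite e => Ic.
  have c0 : forall i, c (inl i) = 0.
    apply: ib; apply/addgens1P.
    exists (comb b (c \o inl) + comb b' (c \o inr) * f), (- comb b' (c \o inr)).
    by split=> //; rewrite mulNr addrK.
  have c1 : forall j, c (inr j) = 0.
    apply: ib'; rewrite /= /colon_set.
    rewrite (_ : comb b (c \o inl) = 0) ?add0r // in Ic.
    by rewrite -(comb0 b); congr comb; apply/funext.
  by case.
Qed.

End HilbertFunction.

(** * Prime filtrations and filter-regular elements *)

(** A classical equality test, so that ideals can be members of lists and be counted with
    multiplicity. *)
HB.instance Definition _ (R : comNzRingType) := gen_eqMixin (ideal R).

Section Primes.
Variables (k : fieldType) (r : nat) (d : 'I_r -> nat).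
Local Notation A := (multiring k d).
Implicit Types (nu mu : 'X_{1..r}) (f g h : A) (I J K p q : ideal A).

(* [pfilt I s]: I = F_0 < F_1 < ... < F_n = A with F_(i+1) / F_i isomorphic to
   A / s_i up to a shift and s_i prime. *)
Inductive pfilt : ideal A -> seq (ideal A) -> Prop :=
| PfiltNil I : I 1 -> pfilt I [::]
| PfiltCons I mu f s : graded_ideal I -> homogeneous mu f -> prime_ideal (colon I f) ->
    pfilt (addgens I [:: f]) s -> pfilt I (colon I f :: s).

(** An annihilator maximal among those of homogeneous elements outside [I] is prime: if [a * b * f]
    is in [I] and [a * f] is not, maximality forces [colon I (a * f)], which contains [b], back into
    [colon I f]. *)
Lemma exists_prime_colon I : graded_ideal I -> ~ I 1 ->
  exists mu f, [/\ homogeneous mu f, ~ I f & prime_ideal (colon I f)].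
Proof.
move=> gI nI1.
pose P K := exists mu f, [/\ homogeneous mu f, ~ I f & K = colon I f].
have P1 : P (colon I 1) by exists 0%MM, 1; split=> //; exact: homogC.
have [K [[mu [f [hf nIf ->]]] _ Kmax]] := exists_maximal P1.
exists mu, f; split=> //; apply: homogeneous_prime; first exact: graded_colon hf.
  by rewrite /= /colon_set mul1r.
move=> nua nub a b ha hb; have [|na] := pselect (colon I f a); first by left.
move=> Iabf; right; apply: (Kmax (colon I (a * f))).
- by exists (nua + mu)%MM, (a * f); split=> //; exact: homogM.
- by move=> x; rewrite /= /colon_set mulrCA; exact: idealM.
- by move: Iabf; rewrite /= /colon_set mulrA [b * a]mulrC.
Qed.

Lemma pfilt_exists I : graded_ideal I -> exists s, pfilt I s.
Proof.
elim/noetherian_ind: I => I IH gI.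
have [I1|nI1] := pselect (I 1); first by exists [::]; exact: PfiltNil.
have [mu [f [hf nIf pf]]] := exists_prime_colon gI nI1.
have [||s hs] := IH (addgens I [:: f]) (@sub_addgens _ _ _).
- by move=> h; apply: nIf; apply: h; exact: mem_addgens1.
- exact: graded_addgens1 hf.
by exists (colon I f :: s); exact: PfiltCons gI hf pf hs.
Qed.

Lemma pfilt_mem I s p : pfilt I s -> p \in s ->
  [/\ graded_ideal p, prime_ideal p & I `<=` p].
Proof.
elim=> // {}I mu f {}s gI hf pf _ IH; rewrite inE => /predU1P[->|/IH[gp pp Ip]].
  by split=> //; [exact: graded_colon hf|exact: sub_colon].
by split=> //; apply: subset_trans Ip; exact: sub_addgens.
Qed.

Lemma pfilt_irrelevant I s : pfilt I s -> (forall p, p \in s -> ~ relevant p) ->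
  eventually (full_in I).
Proof.
elim=> {I s}[I I1 _|I mu f s gI hf pf _ IH irr].
  by exists 0%MM => nu g _; rewrite -[g]mulr1; exact: idealM.
have fI : eventually (full_in (addgens I [:: f])).
  by apply: IH => p ps; apply: irr; rewrite inE ps orbT.
have fp : eventually (full_in (colon I f)).
  by apply: irrelevant_full; apply: irr; rewrite mem_head.
apply: eventually_imp (eventually_and fI (eventually_unshift mu fp)) => nu [h1 h2] g hg.
have [//|[u [a [t [Iu ha hu et ->]]]]] := addgens1_homogeneous gI hf hg (h1 g hg).
by apply: idealD => //; exact: h2 et a ha.
Qed.

(** Unbundled from [multiproj], so that one ideal can serve as a point for [J] and for ideals below
    or above it. *)
Definition point J p := [/\ prime_ideal p, graded_ideal p, relevant p & J `<=` p].

(** If every prime of a filtration were irrelevant, all its factors, hence A/K, would vanish in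
    large degrees. *)
Lemma exists_point K : graded_ideal K -> ~ eventually (full_in K) -> exists p, point K p.
Proof.
move=> gK nf; have [s hs] := pfilt_exists gK; apply: contrapT => no; apply: nf.
apply: (pfilt_irrelevant hs) => p ps rp; apply: no; exists p.
by have [] := pfilt_mem hs ps.
Qed.

(* At the first step of a prime filtration whose prime lies in p, the previous
   primes contain elements outside p, whose product pulls the step back to I. *)
Lemma exists_associated_sub I p : graded_ideal I -> prime_ideal p -> graded_ideal p ->
  I `<=` p -> exists nu f, [/\ homogeneous nu f, prime_ideal (colon I f) & colon I f `<=` p].
Proof.
move=> gI pp gp; have [s hs] := pfilt_exists gI; elim: hs => {I gI s}[I I1 /(_ _ I1)|].
  by have [] := pp.
move=> I mu f s gI hf pf _ IH Ip.
have [fp|nfp] := pselect (colon I f `<=` p); first by exists mu, f.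
have [nu [a [ha Iaf npa]]] := exists_homogeneous_notin (graded_colon gI hf) nfp.
have pf' : p f by have [//|] := pp.2 a f (Ip _ Iaf).
have [|t [g [hg pg gp']]] := IH.
  by move=> x /addgens1P[u [b [Iu ->]]]; apply: idealD; [exact: Ip|exact: idealM].
have e : colon I (a * g) = colon (addgens I [:: f]) g.
  apply: ideal_ext => x; rewrite /= /colon_set; split.
    rewrite mulrCA => /(@sub_addgens _ _ [:: f]) h.
    have [|/gp'|] // := pg.2 a x; by rewrite /= /colon_set -mulrA.
  move=> /addgens1P[u [b [Iu e]]]; rewrite mulrCA e mulrDr; apply: idealD.
    exact: idealM.
  by rewrite mulrCA; exact: idealM.
by exists (nu + t)%MM, (a * g); rewrite e; split=> //; exact: homogM.
Qed.

Lemma filter_regular_notin I h p : graded_ideal I -> filter_regular I h -> point I p ->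
  exists q, [/\ point I q, q `<=` p & ~ q h].
Proof.
move=> gI hreg [pp gp rp Ip].
have [nu [f [hf pf fp]]] := exists_associated_sub gI pp gp Ip.
have rf : relevant (colon I f) by move=> N; apply: rp; exact: subset_trans fp.
exists (colon I f); split=> //.
  by split=> //; [exact: graded_colon hf|exact: sub_colon].
by apply: hreg => //; split=> //; exists f.
Qed.

Lemma filter_regular_dim_drop I mu h p : graded_ideal I -> homogeneous mu h ->
  filter_regular I h -> point (addgens I [:: h]) p ->
  exists q, [/\ point I q, q `<=` p & ~ (p `<=` q)].
Proof.
move=> gI hh hreg [pp gp rp Ip].
have [|q [ptq qp nqh]] := filter_regular_notin (p := p) gI hreg.
  by split=> //; apply: subset_trans Ip; exact: sub_addgens.
by exists q; split=> // pq; apply: nqh; apply: pq; apply: Ip; exact: mem_addgens1.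
Qed.

Lemma colon_colon I f g : colon (colon I f) g = colon I (g * f).
Proof. by apply: ideal_ext => x; rewrite /= /colon_set mulrA. Qed.

(* Each homogeneous f in (I : h) has (I : f) full in large degrees; a maximal
   ideal between I and (I : h) which agrees with I in large degrees is (I : h). *)
Lemma filter_regular_colon I mu h : graded_ideal I -> homogeneous mu h ->
  filter_regular I h ->
  eventually (fun nu => forall f, homogeneous nu f -> colon I h f <-> I f).
Proof.
move=> gI hh hreg; have gIh := graded_colon gI hh.
have full f nu : homogeneous nu f -> colon I h f -> eventually (full_in (colon I f)).
  move=> hf Ihf; apply: contrapT => nf; have gIf := graded_colon gI hf.
  have [p [pp gp rp Ip]] := exists_point gIf nf.
  have [t [g [hg pg gp']]] := exists_associated_sub gIf pp gp Ip.
  apply: (hreg (colon (colon I f) g)).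
  - by split=> //; exists (g * f); rewrite colon_colon.
  - by move=> N; apply: rp; exact: subset_trans gp'.
  - by rewrite colon_colon /= /colon_set mulrCA; apply: idealM; rewrite mulrC.
pose P L := [/\ graded_ideal L, L `<=` colon I h &
  eventually (fun nu => forall f, homogeneous nu f -> L f -> I f)].
have PI : P I by split=> //; [exact: sub_colon|exists 0%MM].
have [L [[gL LIh evL] IL Lmax]] := exists_maximal PI.
have LE : colon I h `<=` L.
  apply: sub_homogeneous => // nu f hf Ihf.
  apply: (Lmax (addgens L [:: f])); last exact: mem_addgens1.
    split; first exact: graded_addgens1 hf.
      by move=> x /addgens1P[u [a [Lu ->]]]; apply: idealD; [exact: LIh|exact: idealM].
    apply: eventually_imp (eventually_and evL (eventually_unshift nu (full f nu hf Ihf))).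
    move=> t [h1 h2] g hg /(addgens1_homogeneous gL hf hg) [/h1|]; first exact.
    move=> [u [a [s [Lu ha hu et ->]]]]; apply: idealD; first exact: h1.
    exact: h2 et a ha.
  exact: sub_addgens.
apply: eventually_imp evL => nu hnu f hf; split; last exact: sub_colon.
by move=> Ihf; apply: hnu => //; exact: LE.
Qed.

(* The primes decrease, so the closures of the points increase with i. *)
Definition point_chain J m (p : nat -> ideal A) :=
  (forall i, (i <= m)%N -> point J (p i)) /\
  (forall i, (i < m)%N -> p i.+1 `<=` p i /\ ~ (p i `<=` p i.+1)).

Lemma filter_regular_cons J z zs : filter_regular_seq J (z :: zs) ->
  filter_regular J z /\ filter_regular_seq (addgens J [:: z]) zs.
Proof.
move=> h; split; first by have /= := h 0%N; rewrite addgens_nil; exact.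
by move=> l lz; have /= := h l.+1; rewrite addgens_cons; exact.
Qed.

(** The list of directions allows the cuts to be treated one at a time, which the doubly indexed
    family does not. *)
Definition linear_seq (is_ : seq 'I_r) (zs : seq A) :=
  size is_ = size zs /\
  forall l i0, (l < size zs)%N -> homogeneous U_(nth i0 is_ l)%MM zs`_l.

Lemma linear_cons is_ z zs : linear_seq is_ (z :: zs) -> exists i is',
  [/\ is_ = i :: is', homogeneous U_(i)%MM z & linear_seq is' zs].
Proof.
case: is_ => [|i is'] [] //= [es] h; exists i, is'; split=> //; first exact: (h 0%N i).
by split=> // l i0 lz; exact: (h l.+1 i0).
Qed.

(** Undoing a cut adds one smaller prime at the end of the chain, by [filter_regular_dim_drop]
    applied to its last member. *)
Lemma chain_filter_regular J is_ zs m (p : nat -> ideal A) : graded_ideal J -> linear_seq is_ zs ->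
  filter_regular_seq J zs -> point_chain (addgens J zs) m p ->
  exists p' : nat -> ideal A, point_chain J (m + size zs) p'.
Proof.
elim: zs J is_ m p => [|z zs IH] J is_ m p gJ lin hreg.
  by rewrite addgens_nil addn0 => h; exists p.
have [i [is' [_ hz lin']]] := linear_cons lin.
have [rz rzs] := filter_regular_cons hreg.
rewrite addgens_cons => /(IH _ _ _ _ (graded_addgens1 gJ hz) lin' rzs) [p' [pt inc]].
have [q [ptq qp npq]] := filter_regular_dim_drop gJ hz rz (pt _ (leqnn _)).
exists (fun j => if (j <= m + size zs)%N then p' j else q).
rewrite /= addnS; split=> j.
  move=> _; case: leqP => // le; have [pp gp rp Jp] := pt j le.
  by split=> //; apply: subset_trans Jp; exact: sub_addgens.
rewrite ltnS leq_eqVlt => /predU1P[->|lt]; last by rewrite lt orbT; exact: inc.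
by rewrite eqxx ltnn.
Qed.

(** The points containing [p i] form a closed set with generic point [p i]. A closed set containing
    that point contains them all, which gives irreducibility; the generic points also make the
    inclusions strict. *)
Lemma dim_multiproj_chain J D m (p : nat -> ideal A) :
  dim_multiproj J D -> point_chain J m p -> (m <= D)%N.
Proof.
move=> [_ dimD] [pt inc].
pose C i : set (multiproj J) := [set q | p i `<=` q].
have mk i : (i <= m)%N -> exists q : multiproj J, pt_ideal q = p i.
  by move=> /pt[pp gp rp Jp]; exists (MultiProj pp gp rp Jp).
apply: (dimD m C); split=> [i im|i im].
  have [q qE] := mk i im; have [_ gp _ _] := pt i im; split.
  - by exists (p i).
  - by exists q; rewrite /C /= qE => x.
  - move=> _ _ [I1 [_ ->]] [I2 [_ ->]] CE.
    have : C i q by rewrite /C /= qE => x.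
    rewrite CE => -[] /=; rewrite qE => Iq; [left|right]; rewrite -CE;
      apply/seteqP; split=> x px; [exact: subset_trans Iq px| |exact: subset_trans Iq px|].
    + by rewrite CE; left.
    + by rewrite CE; right.
have [sub nsub] := inc i im; have [q qE] := mk i.+1 im.
split=> [x /= px|CC]; first exact: subset_trans sub px.
by apply: nsub; rewrite -qE; apply: CC; rewrite /C /= qE => x.
Qed.

(** A strict inclusion after the cuts is a chain of length 1; undoing the cuts makes it one longer
    than the dimension. *)
Lemma filter_regular_points J is_ zs : graded_ideal J -> dim_multiproj J (size zs) ->
  linear_seq is_ zs -> filter_regular_seq J zs ->
  forall p q, point (addgens J zs) p -> point (addgens J zs) q -> p `<=` q -> p = q.
Proof.
move=> gJ dimJ lin hreg p q ptp ptq pq; apply: contrapT => npq.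
have [|p' hp'] := chain_filter_regular (m := 1) (p := fun i => if i is 0%N then q else p)
  gJ lin hreg.
  split=> [[|i] //|[|i] // _]; split=> // qp.
  by apply: npq; apply: ideal_ext => x; split; [exact: pq|exact: qp].
by have := dim_multiproj_chain dimJ hp'; rewrite add1n ltnn.
Qed.

End Primes.

(** * Hilbert polynomials in the binomial basis *)

Section BinomialType.
Variables (r : nat).
Implicit Types (nu mu m : 'X_{1..r}) (s t : {mpoly rat[r]}).

Lemma mnm_ind (P : 'X_{1..r} -> Prop) :
  P 0%MM -> (forall m i, P m -> P (m + U_(i))%MM) -> forall m, P m.
Proof.
move=> P0 PS m; move: {2}(mdeg m) (leqnn (mdeg m)) => D.
elim: D m => [|D IH] m; first by rewrite leqn0 mdeg_eq0 => /eqP->.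
move=> mD; have [->//|/eqP m0] := m =P 0%MM.
have [i mi] : exists i, m i != 0%N.
  apply: contrapT => no; move/eqP: m0; apply; apply/mnmP => i; rewrite mnm0E.
  by apply/eqP; apply: contrapT => /negP mi; apply: no; exists i.
have e : (m - U_(i) + U_(i) = m)%MM by rewrite submK // lep1mP.
by rewrite -e; apply: PS; apply: IH; move: mD; rewrite -{1}e mdegD mdeg1 addn1.
Qed.

Definition mbin nu m : nat := \prod_(i < r) 'C(nu i + m i, m i).

(* The basis of binomials prod_i C(X_i + m_i, m_i) is encoded by the monomials
   'X_[m]: multiplication by 'X_i is then summation in the i-th direction. *)
Definition beval nu s : rat := \sum_(m <- msupp s) s@_m * (mbin nu m)%:R.

Lemma beval_sub nu s (L : seq 'X_{1..r}) : uniq L -> {subset msupp s <= L} ->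
  beval nu s = \sum_(m <- L) s@_m * (mbin nu m)%:R.
Proof.
move=> uL sL; rewrite (bigID (mem (msupp s))) /= [X in _ + X]big1 ?addr0; last first.
  by move=> m /memN_msupp_eq0->; rewrite mul0r.
rewrite -big_filter; apply: perm_big; apply: uniq_perm; rewrite ?filter_uniq //.
by move=> m; rewrite mem_filter; case: (boolP (m \in msupp s)) => //= /sL->.
Qed.

Lemma bevalD nu s t : beval nu (s + t) = beval nu s + beval nu t.
Proof.
pose L := undup (msupp s ++ msupp t ++ msupp (s + t)).
have sL u : u \in [:: s; t; s + t] -> {subset msupp u <= L}.
  by rewrite !inE => /or3P[]/eqP-> m; rewrite mem_undup !mem_cat => ->; rewrite ?orbT.
rewrite !(@beval_sub _ _ L) ?undup_uniq //; try by apply: sL; rewrite !inE eqxx ?orbT.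
by rewrite -big_split /=; apply: eq_bigr => m _; rewrite mcoeffD mulrDl.
Qed.

Lemma bevalZ nu c s : beval nu (c *: s) = c * beval nu s.
Proof.
rewrite !(@beval_sub _ _ (msupp s)) ?msupp_uniq //; last exact: msuppZ_le.
by rewrite mulr_sumr; apply: eq_bigr => m _; rewrite mcoeffZ mulrA.
Qed.

Lemma bevalB nu s t : beval nu (s - t) = beval nu s - beval nu t.
Proof. by rewrite -scaleN1r bevalD bevalZ mulN1r. Qed.

Lemma beval0 nu : beval nu 0 = 0.
Proof. by rewrite /beval msupp0 big_nil. Qed.

Lemma bevalX nu m : beval nu 'X_[m] = (mbin nu m)%:R.
Proof. by rewrite /beval msuppX big_seq1 mcoeffX eqxx mul1r. Qed.

Lemma beval_sum nu (T : Type) (l : seq T) (P : pred T) (F : T -> {mpoly rat[r]}) :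
  beval nu (\sum_(i <- l | P i) F i) = \sum_(i <- l | P i) beval nu (F i).
Proof. exact: (big_morph _ (bevalD nu) (beval0 nu)). Qed.

Lemma bevalC nu c : beval nu c%:MP = c.
Proof.
rewrite -[c%:MP]mulr1 mul_mpolyC bevalZ -mpolyX0 bevalX.
by rewrite /mbin big1 ?mulr1 // => i _; rewrite mnm0E bin0.
Qed.

(** Pascal's rule in the i-th factor, the others being unchanged. *)
Lemma mbinU nu m i : mbin (nu + U_(i)) (m + U_(i)) =
  (mbin nu (m + U_(i)) + mbin (nu + U_(i)) m)%N.
Proof.
rewrite /mbin (bigD1 i) //= [X in _ = (X + _)%N](bigD1 i) //= [X in _ = (_ + X)%N](bigD1 i) //=.
rewrite !mnmDE !mnm1E eqxx /=.
have e j : j != i -> ((nu + U_(i))%MM j = nu j) * ((m + U_(i))%MM j = m j).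
  by move=> ji; rewrite !mnmDE !mnm1E eq_sym (negPf ji) !addn0.
rewrite (eq_bigr (fun j => 'C(nu j + m j, m j))) => [|j /e[-> ->]//].
rewrite [X in _ = (_ * X + _)%N](eq_bigr (fun j => 'C(nu j + m j, m j))) => [|j /e[_ ->]//].
rewrite [X in _ = (_ + _ * X)%N](eq_bigr (fun j => 'C(nu j + m j, m j))) => [|j /e[-> _]//].
by rewrite -mulnDl !addn1 !addnS addSn binS.
Qed.

Lemma beval_mulX nu s i :
  beval (nu + U_(i))%MM (s * 'X_i) = beval nu (s * 'X_i) + beval (nu + U_(i))%MM s.
Proof.
rewrite [s]mpolyE mulr_suml !beval_sum -big_split /=; apply: eq_bigr => m _.
by rewrite -scalerAl -mpolyXD !bevalZ !bevalX mbinU natrD mulrDr.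
Qed.

Lemma beval_free nu s i : (forall m, m i != 0%N -> s@_m = 0) ->
  beval (nu + U_(i))%MM s = beval nu s.
Proof.
move=> h; apply: eq_bigr => m _.
have [mi|/h->] := eqVneq (m i) 0%N; last by rewrite !mul0r.
congr (_ * _%:R); apply: eq_bigr => j _; rewrite mnmDE mnm1E.
by case: eqP => [<-|]; rewrite ?addn0 // mi !bin0.
Qed.

(** The backward difference in direction i, read on coefficients. Terms with [m i = 0] have
    difference zero and are left out, since [m - U_(i)] would truncate. *)
Definition down i s : {mpoly rat[r]} :=
  \sum_(m <- msupp s | m i != 0%N) s@_m *: 'X_[m - U_(i)].

Lemma down_split i s : exists2 s0, s = down i s * 'X_i + s0 &
  forall m, m i != 0%N -> s0@_m = 0.
Proof.
exists (\sum_(m <- msupp s | m i == 0%N) s@_m *: 'X_[m]); last first.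
  move=> m mi; rewrite raddf_sum big1 //= => m' m'i; rewrite mcoeffZ mcoeffX.
  by case: (m' =P m) mi => [<-|_ _]; rewrite ?m'i ?mulr0.
rewrite {1}[s]mpolyE (bigID (fun m => m i == 0%N)) /= addrC; congr (_ + _).
rewrite mulr_suml; apply: eq_bigr => m mi.
by rewrite -scalerAl -mpolyXD submK // lep1mP.
Qed.

Lemma mcoeff_down i s m : (down i s)@_m = s@_(m + U_(i)).
Proof.
have [s0 {2}-> h] := down_split i s; rewrite mcoeffD h ?addr0.
  by rewrite addmC mcoeffMX.
by rewrite mnmDE mnm1E eqxx addn1.
Qed.

Lemma beval_diff nu s i :
  beval (nu + U_(i))%MM s = beval nu s + beval (nu + U_(i))%MM (down i s).
Proof.
have [s0 e h] := down_split i s.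
by rewrite {1 2}e !bevalD beval_mulX (beval_free _ h) addrAC.
Qed.

(** The differences in all directions have smaller degree and also vanish eventually, so they are
    zero by induction; a constant remains, whose value is 0. *)
Lemma beval_unique s : eventually (fun nu => beval nu s = 0) -> s = 0.
Proof.
suff H D t : (forall m, t@_m != 0 -> (mdeg m < D)%N) ->
    eventually (fun nu => beval nu t = 0) -> t = 0.
  by apply: (H (msize s)) => m; rewrite -mcoeff_msupp; exact: msize_mdeg_lt.
elim: D t => [|D IH] t ht ev.
  by apply/mpolyP => m; rewrite mcoeff0; apply/eqP; apply: contrapT => /negP /ht.
have d0 i : down i t = 0.
  apply: IH => [m|].
    by rewrite mcoeff_down => /ht; rewrite mdegD mdeg1 addn1 ltnS.
  have [a ha] := ev; exists (a + U_(i))%MM => nu.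
  have := beval_diff (a + nu)%MM t i.
  by rewrite -[X in beval X t = _]addmA !ha add0r -!addmA [(nu + _)%MM]addmC => <-.
have tE : t = (t@_0)%:MP.
  apply/mpolyP => m; rewrite mcoeffC; have [->|m0] := eqVneq m 0%MM; first by rewrite mulr1.
  rewrite mulr0; elim/mnm_ind: m m0 => [|m i _ _]; first by rewrite eqxx.
  by rewrite -mcoeff_down d0 mcoeff0.
by have [a ha] := ev; have := ha 0%MM; rewrite tE bevalC => ->; rewrite mpolyC0.
Qed.

Lemma beval_shift mu s : exists t, forall nu, beval nu s = beval (nu + mu)%MM t.
Proof.
elim/mnm_ind: mu => [|mu i [t ht]]; first by exists s => nu; rewrite addm0.
exists (t - down i t) => nu.
by rewrite ht addmA bevalB [X in X - _]beval_diff addrK.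
Qed.

Lemma eventually_of_shift mu (P : 'X_{1..r} -> Prop) :
  eventually (fun nu => P (nu + mu)%MM) -> eventually P.
Proof.
move=> [a ha]; exists (a + mu)%MM => nu.
by rewrite -addmA [(mu + _)%MM]addmC addmA.
Qed.

Definition binomial_type (F : 'X_{1..r} -> rat) :=
  exists s, eventually (fun nu => F nu = beval nu s).

Lemma eventually_constant (T : Type) (F : 'X_{1..r} -> T) :
  (forall i, eventually (fun nu => F (nu + U_(i))%MM = F nu)) ->
  exists c, eventually (fun nu => F nu = c).
Proof.
move=> /eventually_forall[a ha]; exists (F a), a.
elim/mnm_ind => [|m i IH]; first by rewrite addm0.
by rewrite addmA ha.
Qed.

(* Summation: subtract from F its sum in one direction after the other, until F
   is invariant in every direction. *)
Lemma binomial_type_sum (F : 'X_{1..r} -> rat) :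
  (forall i, exists Q, eventually (fun nu =>
     F (nu + U_(i))%MM = F nu + beval (nu + U_(i))%MM Q)) ->
  binomial_type F.
Proof.
(* [n] bounds the number of directions still to be treated: those of index below [r - n] are already
   invariant. *)
suff H n (G : 'X_{1..r} -> rat) :
    (forall i : 'I_r, (i < r - n)%N -> eventually (fun nu => G (nu + U_(i))%MM = G nu)) ->
    (forall i, exists Q, eventually (fun nu =>
      G (nu + U_(i))%MM = G nu + beval (nu + U_(i))%MM Q)) -> binomial_type G.
  by apply: (H r) => i; rewrite subnn.
elim: n G => [|n IH] G inv sumQ.
  have [|c [a ha]] := @eventually_constant _ G; first by move=> i; apply: inv; rewrite subn0.
  by exists c%:MP, a => nu; rewrite bevalC.
have [rn|nr] := leqP r n.
  (* By computation [rn] is the boolean equality [r - n == 0], so no invariance is asked for. *)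
  by apply: IH => // i; rewrite (eqP rn).
have ltr : (r - n.+1 < r)%N by lia.
pose i0 := Ordinal ltr; have [Q evQ] := sumQ i0.
pose S := Q * 'X_i0.
have [s evs] : binomial_type (fun nu => G nu - beval nu S).
  apply: IH => [i|i].
    move=> ilt; have [->|ii0] := eqVneq i i0.
      apply: eventually_imp evQ => nu ->; rewrite beval_mulX; ring.
    have evi : eventually (fun nu => G (nu + U_(i))%MM = G nu).
      apply: inv; move: ilt ii0; rewrite -val_eqE /=; lia.
    (* Invariance of [G] in direction i passes to its difference in direction i0, hence to [Q]. So
       [S] does not involve 'X_i, and subtracting it preserves the invariance. *)
    have Q0 : down i Q = 0.
      apply: beval_unique; apply: (@eventually_of_shift (U_(i) + U_(i0))%MM).
      apply: eventually_imp (eventually_and (eventually_and evQ evi) (eventually_and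
        (eventually_shift U_(i) evQ) (eventually_shift U_(i0) evi))).
      move=> nu [[e1 e2] [e3 e4]].
      have := beval_diff (nu + U_(i0))%MM Q i.
      rewrite -!addmA [(U_(i0) + _)%MM]addmC !addmA => h.
      have e5 : (nu + U_(i0) + U_(i) = nu + U_(i) + U_(i0))%MM.
        by rewrite -!addmA [(U_(i0) + _)%MM]addmC.
      move: e3 e4; rewrite e5 => ->; rewrite e2 e1 h => /addrI/eqP.
      by rewrite -subr_eq0 addrAC subrr add0r => /eqP.
    have S0 m : m i != 0%N -> S@_m = 0.
      move=> mi; apply: memN_msupp_eq0; apply/negP => /msuppM_le.
      move=> /allpairsP[[m1 m2] /= [m1Q]]; rewrite msuppX inE => /eqP-> mE.
      move: mi; rewrite mE mnmDE mnm1E (eq_sym i0) (negPf ii0) addn0 => m1i.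
      move: m1Q; rewrite mcoeff_msupp.
      have -> : m1 = (m1 - U_(i) + U_(i))%MM by rewrite submK // lep1mP.
      by rewrite -mcoeff_down Q0 mcoeff0 eqxx.
    by apply: eventually_imp evi => nu ->; rewrite (beval_free _ S0).
  have [Qi evi] := sumQ i; exists (Qi - down i S).
  apply: eventually_imp evi => nu ->; rewrite bevalB [beval _ S]beval_diff; ring.
by exists (s + S); apply: eventually_imp evs => nu; rewrite bevalD => <-; rewrite subrK.
Qed.

Lemma binomial_mpolyE nu m :
  (binomial_mpoly m).@[fun i => (nu i)%:R] = (mbin nu m)%:R.
Proof.
rewrite /binomial_mpoly rmorph_prod /= /mbin natr_prod; apply: eq_bigr => i _.
rewrite mevalZ rmorph_prod /=.
under eq_bigr do rewrite mevalD mevalXU raddfMn /= meval1 -natrD.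
rewrite -natr_prod.
have fact_neq0 : (m i)`!%:R != 0 :> rat by rewrite Num.Theory.pnatr_eq0 -lt0n fact_gt0.
apply: (mulfI fact_neq0); rewrite mulVKf // -natrM; congr _%:R.
have prodE n j : (\prod_(1 <= l < j.+1) (n + l) * n`! = (n + j)`!)%N.
  elim: j => [|j IH]; first by rewrite big_geq // mul1n addn0.
  by rewrite big_nat_recr //= mulnAC IH addnS factS mulnC.
apply/eqP; rewrite -(eqn_pmul2r (fact_gt0 (nu i))) prodE; apply/eqP.
by rewrite -(@bin_fact (nu i + m i) (m i)) ?leq_addl // addnK; lia.
Qed.

End BinomialType.

(** * Existence of Hilbert polynomials and their change under cuts *)

Section HilbertPolynomial.
Variables (k : fieldType) (r : nat) (d : 'I_r -> nat).
Local Notation A := (multiring k d).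
Implicit Types (nu mu : 'X_{1..r}) (f g h : A) (I J K p q : ideal A).

Lemma colon_prime p t : prime_ideal p -> ~ p t -> colon p t = p.
Proof.
move=> pp pt; apply: ideal_ext => x; rewrite /= /colon_set; split; last exact: idealMr.
by move=> /pp.2[].
Qed.

Lemma hilb_prime_mul p nu mu t : prime_ideal p -> graded_ideal p -> homogeneous mu t ->
  ~ p t -> hilb p (nu + mu)%MM = (hilb (addgens p [:: t]) (nu + mu)%MM + hilb p nu)%N.
Proof. by move=> pp gp ht pt; rewrite (hilb_addgens1 _ gp ht) colon_prime. Qed.

Lemma hilb_eventually_full I : eventually (full_in I) -> eventually (fun nu => hilb I nu = 0%N).
Proof. by apply: eventually_imp => nu /hilb_full. Qed.

(** If [I] is a relevant prime, its differences come from the larger ideals [I + (t)], one variable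
    [t] outside [I] per direction. If [I] is proper and not prime, the exact sequence for some [f]
    splits the function into those of two larger ideals. *)
Lemma hilb_binomial_type I : graded_ideal I -> binomial_type (fun nu => (hilb I nu)%:R).
Proof.
elim/noetherian_ind: I => I IH gI.
have IHa mu f : homogeneous mu f -> ~ I f ->
    binomial_type (fun nu => (hilb (addgens I [:: f]) nu)%:R).
  move=> hf nIf; apply: IH; first exact: sub_addgens.
    by move=> h; apply: nIf; apply: h; exact: mem_addgens1.
  exact: graded_addgens1 hf.
have zero : eventually (full_in I) -> binomial_type (fun nu => (hilb I nu)%:R).
  by move=> /hilb_eventually_full ev; exists 0; apply: eventually_imp ev => nu ->; rewrite beval0.
have [I1|nI1] := pselect (I 1).
  by apply: zero; exists 0%MM => nu f _; rewrite -[f]mulr1; exact: idealM.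
have [rI|/irrelevant_full/zero//] := pselect (relevant I).
have [pI|npI] := pselect (prime_ideal I).
  apply: binomial_type_sum => i; have [t ht nIt] := relevant_var i rI.
  have [Q evQ] := IHa _ _ ht nIt; exists Q.
  apply: eventually_imp (eventually_shift U_(i)%MM evQ) => nu <-.
  by rewrite (hilb_prime_mul _ pI gI ht nIt) natrD addrC.
have [mu [f [hf nIf pf]]] := exists_prime_colon gI nI1.
have [s1 ev1] := IHa _ _ hf nIf.
have [|||s2 ev2] := IH (colon I f); first exact: sub_colon.
(* The inclusion is strict because [colon I f] is prime and [I] is not. *)
- move=> h; apply: npI; rewrite (_ : I = colon I f) //.
  by apply: ideal_ext => x; split; [exact: sub_colon|exact: h].
- exact: graded_colon hf.
have [s2' s2E] := beval_shift mu s2; exists (s1 + s2').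
apply: (@eventually_of_shift _ mu).
apply: eventually_imp (eventually_and (eventually_shift mu ev1) ev2) => nu [e1 e2].
by rewrite (hilb_addgens1 _ gI hf) natrD e1 e2 bevalD s2E.
Qed.

Lemma hilb_filter_regular_seq J is_ zs s : graded_ideal J -> linear_seq is_ zs ->
  filter_regular_seq J zs -> eventually (fun nu => (hilb J nu)%:R = beval nu s) ->
  exists2 t, eventually (fun nu => (hilb (addgens J zs) nu)%:R = beval nu t) &
    forall m, t@_m = s@_(m + \sum_(i <- is_) U_(i)).
Proof.
elim: zs is_ J s => [|z zs IH] is_ J s gJ lin hreg ev.
  exists s; first by rewrite addgens_nil.
  by case: is_ lin => [|i is_] [] // _ _ m; rewrite big_nil addm0.
have [i [is' [-> hz lin']]] := linear_cons lin.
have [rz rzs] := filter_regular_cons hreg.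
have evz : eventually (fun nu => (hilb (addgens J [:: z]) nu)%:R = beval nu (down i s)).
  apply: (@eventually_of_shift _ U_(i)%MM).
  apply: eventually_imp (eventually_and (filter_regular_colon gJ hz rz)
    (eventually_and ev (eventually_shift U_(i)%MM ev))) => nu [/eq_hilb e1 [e2 e3]].
  have /(congr1 (fun n => n%:R : rat)) := hilb_addgens1 nu gJ hz.
  by rewrite natrD e1 e2 e3 beval_diff [RHS]addrC => /addrI.
have [t evt tE] := IH _ _ _ (graded_addgens1 gJ hz) lin' rzs evz.
exists t; first by rewrite addgens_cons.
by move=> m; rewrite tE mcoeff_down big_cons -addmA [(_ + U_(i))%MM]addmC.
Qed.

Lemma multidegree_beval J s n : eventually (fun nu => (hilb J nu)%:R = beval nu s) ->
  multidegree J n s@_n.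
Proof.
move=> [a ha]; exists (\sum_(m : 'X_{1..r < msize s}) s@_m *: binomial_mpoly m).
exists (fun m => s@_m), (msize s); split=> //; last first.
  by move=> m /msize_mdeg_ge /memN_msupp_eq0.
exists a => nu le; exists (hilb J nu); first exact: hilbP.
have <- : (a + (nu - a) = nu)%MM by rewrite addmC submK //; apply/mnm_lepP.
rewrite ha [in RHS](mpolywE (leqnn (msize s))) raddf_sum beval_sum /=.
by apply: eq_bigr => m _; rewrite mevalZ binomial_mpolyE bevalZ bevalX.
Qed.

End HilbertPolynomial.

(** * Schemes of dimension zero *)

Section ZeroDimensional.
Variables (k : fieldType) (r : nat) (d : 'I_r -> nat).
Local Notation A := (multiring k d).
Implicit Types (nu mu : 'X_{1..r}) (f g h : A) (I J K p q : ideal A).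

(** For a variable [t] outside [p], no point contains [p + (t)], so that ideal is full in large
    degrees and multiplication by [t] eventually preserves dimensions. *)
Lemma hilb_maximal_point p : graded_ideal p -> prime_ideal p -> relevant p ->
  (forall q, point p q -> p = q) ->
  exists n, eventually (fun nu => hilb p nu = n).
Proof.
move=> gp pp rp pmax; apply: eventually_constant => i.
have [t ht npt] := relevant_var i rp.
have full : eventually (full_in (addgens p [:: t])).
  apply: contrapT => /(exists_point (graded_addgens1 gp ht)) [q [pq gq rq sq]].
  have e : p = q.
    by apply: pmax; split=> //; apply: subset_trans sq; exact: sub_addgens.
  by apply: npt; rewrite e; apply: sq; exact: mem_addgens1.
apply: eventually_imp (eventually_shift U_(i)%MM (hilb_eventually_full full)) => nu e.
by rewrite (hilb_prime_mul _ pp gp ht npt) e.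
Qed.

(** The shifts of the factors drop out because their Hilbert functions are eventually constant. *)
Lemma hilb_pfilt I s (w : ideal A -> nat) : pfilt I s ->
  (forall p, p \in s -> relevant p -> eventually (fun nu => hilb p nu = w p)) ->
  eventually (fun nu => hilb I nu = \sum_(p <- s | `[< relevant p >]) w p)%N.
Proof.
elim=> {I s} [I I1 _|I mu f s gI hf pf _ IH hw].
  exists 0%MM => nu; rewrite big_nil; apply/hilb_full => f _.
  by rewrite -[f]mulr1; exact: idealM.
have {IH}ev1 := IH (fun p ps => hw p (@mem_behead _ (_ :: s) p ps)).
apply: (@eventually_of_shift _ mu); rewrite big_cons.
have ev2 : eventually (fun nu =>
    hilb (colon I f) nu = if `[< relevant (colon I f) >] then w (colon I f) else 0%N).
  case: asboolP => [rel|/irrelevant_full/hilb_eventually_full//].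
  by apply: hw => //; rewrite mem_head.
apply: eventually_imp (eventually_and (eventually_shift mu ev1) ev2) => nu [e1 e2].
by rewrite (hilb_addgens1 _ gI hf) e1 e2; case: asboolP => _; rewrite addnC.
Qed.

End ZeroDimensional.

(** * Local rings *)

Section Germs.
Variables (k : fieldType) (r : nat) (d : 'I_r -> nat) (J : ideal (multiring k d)).
Variable (y : multiproj J).
Local Notation A := (multiring k d).
Local Notation "x %:F" := (tofrac x).
Local Notation S := (stalk y).
Implicit Types (nu mu : 'X_{1..r}) (f g h s : A) (I p q : ideal A) (x : S).

Definition stalk_pi (z : ambient_stalk y) : S :=
  (\pi_{ideal_quot (@ideal_stalk _ _ _ J y)} z)%qT.

Lemma stalk_piD u v : stalk_pi (u + v) = stalk_pi u + stalk_pi v.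
Proof. by rewrite /stalk_pi; exact: (Quotient.pi_add). Qed.

Lemma stalk_piM u v : stalk_pi (u * v) = stalk_pi u * stalk_pi v.
Proof. by rewrite /stalk_pi; exact: Quotient.pi_mul. Qed.

Lemma stalk_piN u : stalk_pi (- u) = - stalk_pi u.
Proof. by rewrite /stalk_pi; exact: Quotient.pi_opp. Qed.

Lemma stalk_pi1 : stalk_pi 1 = 1.
Proof. by rewrite /stalk_pi !piE. Qed.

Lemma stalk_pi_eq0 u : stalk_pi u = 0 <-> ideal_stalk u.
Proof.
rewrite -[0](_ : stalk_pi 0 = 0); last by rewrite /stalk_pi !piE.
rewrite -{2}[u]subr0 /stalk_pi.
have e := Quotient.idealrBE (@ideal_stalk _ _ _ J y) u 0.
split=> h; last by apply/eqP; rewrite -e.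
suff : u - 0 \in @ideal_stalk _ _ _ J y by [].
by rewrite e; apply/eqP.
Qed.

(** A relation, since an element has many presentations as a fraction. It hides the two layers of
    the stalk, a subring of the fraction field and then a quotient. *)
Definition germ x nu f g := [/\ homogeneous nu f, homogeneous nu g, ~ y g &
  exists2 z : ambient_stalk y, ambient_val z = f%:F / g%:F & x = stalk_pi z].

Lemma germ_exists x : exists nu f g, germ x nu f g.
Proof.
rewrite -[x]reprK; case: (repr x) => z zP.
have /asboolP[nu [f [g [hf hg yg e]]]] := zP.
by exists nu, f, g; split=> //; exists (AmbientStalk zP).
Qed.

Lemma exists_germ nu f g : homogeneous nu f -> homogeneous nu g -> ~ y g ->
  exists x, germ x nu f g.
Proof.
move=> hf hg yg.
have zP : f%:F / g%:F \in ambient_pred y by apply/asboolP; exists nu, f, g.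
by exists (stalk_pi (AmbientStalk zP)); split=> //; exists (AmbientStalk zP).
Qed.

Lemma germD x x' nu nu' f f' g g' : germ x nu f g -> germ x' nu' f' g' ->
  germ (x + x') (nu + nu')%MM (f * g' + f' * g) (g * g').
Proof.
move=> [hf hg yg [z zE ->]] [hf' hg' yg' [z' zE' ->]]; split.
- by apply: homogeneousD; [|rewrite addmC]; exact: homogM.
- exact: homogM.
- exact: pt_mul.
exists (z + z'); last by rewrite stalk_piD.
rewrite (_ : ambient_val (z + z') = ambient_val z + ambient_val z') //.
by rewrite zE zE' (addf_div _ _ (pt_neq0 yg) (pt_neq0 yg')) tofracD !tofracM.
Qed.

Lemma germM x x' nu nu' f f' g g' : germ x nu f g -> germ x' nu' f' g' ->
  germ (x * x') (nu + nu')%MM (f * f') (g * g').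
Proof.
move=> [hf hg yg [z zE ->]] [hf' hg' yg' [z' zE' ->]]; split.
- exact: homogM.
- exact: homogM.
- exact: pt_mul.
exists (z * z'); last by rewrite stalk_piM.
rewrite (_ : ambient_val (z * z') = ambient_val z * ambient_val z') //.
by rewrite zE zE' mulf_div !tofracM.
Qed.

Lemma germN x nu f g : germ x nu f g -> germ (- x) nu (- f) g.
Proof.
move=> [hf hg yg [z zE ->]]; split=> //; first exact: homogeneousN.
exists (- z); last by rewrite stalk_piN.
by rewrite (_ : ambient_val (- z) = - ambient_val z) // zE tofracN mulNr.
Qed.

Lemma germ_scalar c : germ (stalk_scalar y c) 0%MM c%:MP 1.
Proof.
split; [exact: homogC|exact: homogC|exact: pt_one|].
by exists (AmbientStalk (ambient_scalar y c)); rewrite ?tofrac1 ?divr1.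
Qed.

Lemma germ1 : germ 1 0%MM 1 1.
Proof.
split; [exact: homogC|exact: homogC|exact: pt_one|].
exists 1; last by rewrite stalk_pi1.
by rewrite (_ : ambient_val 1 = 1) // tofrac1 divr1.
Qed.

(** The usual criterion for zero in a localization, with a homogeneous multiplier; it turns
    equations in the stalk into memberships in [J]. *)
Lemma germ_eq0 x nu f g : germ x nu f g ->
  x = 0 <-> exists mu s, [/\ homogeneous mu s, ~ y s & J (s * f)].
Proof.
move=> [hf hg yg [z zE ->]]; rewrite stalk_pi_eq0; split.
  move=> /asboolP[mu [f' [g' [hf' hg' Jf' yg']]]]; rewrite zE => /eqP.
  rewrite (eqr_div _ _ (pt_neq0 yg) (pt_neq0 yg')) -!tofracM tofrac_eq => /eqP e.
  by exists mu, g'; split=> //; rewrite mulrC e; exact: idealMr.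
move=> [mu [s [hs ys Jsf]]]; apply/asboolP; exists (mu + nu)%MM, (s * f), (s * g).
split=> //; [exact: homogM|exact: homogM|exact: pt_mul|].
by rewrite zE !tofracM -mulf_div divff ?mul1r // (pt_neq0 ys).
Qed.

Lemma germ0 : germ 0 0%MM 0 1.
Proof.
have [x hx] : exists x, germ x 0%MM 0 1.
  by apply: exists_germ; [exact: homogeneous0|exact: homogC|exact: pt_one].
have <- // : x = 0; apply/(germ_eq0 hx); exists 0%MM, 1; split.
- exact: homogC.
- exact: pt_one.
- by rewrite mulr0; exact: ideal0.
Qed.

Section LocalIdeal.
Variable I : ideal A.

Definition local_set x := exists nu f g, germ x nu f g /\ I f.

Lemma local0 : local_set 0.
Proof. by exists 0%MM, 0, 1; split; [exact: germ0|exact: ideal0]. Qed.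

Lemma localD x x' : local_set x -> local_set x' -> local_set (x + x').
Proof.
move=> [nu [f [g [h If]]]] [nu' [f' [g' [h' If']]]].
do 3 eexists; split; first exact: germD h h'.
by apply: idealD; exact: idealMr.
Qed.

Lemma localM a x : local_set x -> local_set (a * x).
Proof.
move=> [nu [f [g [h If]]]]; have [nu' [f' [g' h']]] := germ_exists a.
by do 3 eexists; split; [exact: germM h' h|exact: idealM].
Qed.

Definition local_ideal : ideal S := Ideal local0 localD localM.

(** The criterion holds for every presentation of [x]: after clearing denominators two of them
    differ by an element of [J], which [I] absorbs. *)
Lemma local_idealP x nu f g : J `<=` I -> germ x nu f g ->
  local_ideal x <-> exists mu s, [/\ homogeneous mu s, ~ y s & I (s * f)].
Proof.
move=> JI hx; split.
  move=> [nu' [f' [g' [hx' If']]]]; have hN := germN hx'.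
  have /(germ_eq0 (germD hx hN)) : x - x = 0 by rewrite subrr.
  move=> [mu [s [hs ys /JI Is]]]; have [_ hg' yg' _] := hx'.
  exists (mu + nu')%MM, (s * g'); split; [exact: homogM|exact: pt_mul|].
  rewrite (_ : s * g' * f = s * (f * g' + - f' * g) + s * g * f'); last by ring.
  by apply: idealD => //; exact: idealM.
move=> [mu [s [hs ys Isf]]]; exists (mu + nu)%MM, (s * f), (s * g); split=> //.
have [hf hg yg [z zE xE]] := hx; split; [exact: homogM|exact: homogM|exact: pt_mul|].
by exists z => //; rewrite zE !tofracM -mulf_div divff ?mul1r // (pt_neq0 ys).
Qed.

End LocalIdeal.

Lemma local_ideal_sub I I' : I `<=` I' -> local_ideal I `<=` local_ideal I'.
Proof. by move=> II' x [nu [f [g [h If]]]]; exists nu, f, g; split=> //; exact: II'. Qed.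

Lemma local_ideal_full I : I 1 -> forall x, local_ideal I x.
Proof.
move=> I1 x; have [nu [f [g h]]] := germ_exists x; exists nu, f, g; split=> //.
by rewrite -[f]mulr1; exact: idealM.
Qed.

Lemma local_ideal0 x : local_ideal J x -> x = 0.
Proof.
have [nu [f [g h]]] := germ_exists x.
by move=> /(local_idealP (@subset_refl _ _) h) /(germ_eq0 h).
Qed.

(** If [f] is outside [y], then [g / f] is an inverse. If [f] is in [y], clearing denominators in
    [x * x' = 1] would put a product of elements outside [y] into [y]. *)
Lemma nonunits_germ x nu f g : germ x nu f g -> nonunits x <-> y f.
Proof.
move=> hx; have [hf hg yg _] := hx; split=> [nx|yf x' xx'].
  apply: contrapT => yf; have [x' hx'] := exists_germ hg hf yf.
  apply: (nx x'); apply/eqP; rewrite -subr_eq0; apply/eqP.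
  apply/(germ_eq0 (germD (germM hx hx') (germN germ1))); exists 0%MM, 1; split.
  - exact: homogC.
  - exact: pt_one.
  - rewrite (_ : 1 * _ = 0); last by ring.
    exact: ideal0.
have [nu' [f' [g' hx']]] := germ_exists x'; have [_ _ yg' _] := hx'.
have /(germ_eq0 (germD (germM hx hx') (germN germ1))) : x * x' - 1 = 0.
  by rewrite xx' subrr.
move=> [mu [s [hs ys /(@pt_sub _ _ _ _ y) ysf]]].
have : y (s * (g * g')).
  rewrite (_ : s * _ = s * f' * f - s * (f * f' * 1 + -1 * (g * g'))); last by ring.
  by apply: idealB => //; exact: idealM.
by apply: pt_mul => //; exact: pt_mul.
Qed.

End Germs.

(** * Length and residue degree at a minimal point *)

Section LocalRing.
Variables (k : fieldType) (r : nat) (d : 'I_r -> nat) (J : ideal (multiring k d)).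
Variable (y : multiproj J).
Local Notation A := (multiring k d).
Local Notation "x %:F" := (tofrac x).
Local Notation S := (stalk y).
Implicit Types (nu mu : 'X_{1..r}) (f g h t : A) (I p q : ideal A) (x : S).

Hypothesis y_minimal : forall q, point J q -> q `<=` y -> q = y.

(** Some homogeneous [b] outside [y] has [b * f] in [I]; locally [b] acts as a unit, so the step
    becomes trivial. *)
Lemma local_ideal_notin I f x : J `<=` I -> graded_ideal I -> graded_ideal (colon I f) ->
  ~ (colon I f `<=` y) -> local_ideal y (addgens I [:: f]) x -> local_ideal y I x.
Proof.
move=> JI gI gc nsub [nu [n [g [hx /addgens1P[u [a [Iu e]]]]]]].
have [mu [b [hb Ibf yb]]] := exists_homogeneous_notin gc nsub.
apply/(local_idealP JI hx); exists mu, b; split=> //.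
by rewrite e mulrDr; apply: idealD; [|rewrite mulrCA]; exact: idealM.
Qed.

(** When [colon I f] is [y], the local quotient is simple: the cofactor of [f] in a numerator of [e]
    lies outside [y], so [e] generates the quotient. *)
Lemma local_ideal_cyclic I mu f e x : J `<=` I -> graded_ideal I -> homogeneous mu f ->
  colon I f = y -> local_ideal y (addgens I [:: f]) e -> ~ local_ideal y I e ->
  local_ideal y (addgens I [:: f]) x -> exists a c, local_ideal y I c /\ x = c + a * e.
Proof.
move=> JI gI hf colonE [nu [n [g [he In]]]] nIe [nu' [n' [g' [hx In']]]].
have [hn hg yg _] := he; have [hn' hg' yg' _] := hx.
have [In1|[u [a [t [Iu ha hu nuE nE]]]]] := addgens1_homogeneous gI hf hn In.
  by case: nIe; exists nu, n, g.
have ya : ~ y a.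
  move=> ya; apply: nIe; exists nu, n, g; split=> //; rewrite nE; apply: idealD => //.
  by move: ya; rewrite -colonE.
have [In1'|[u' [a' [t' [Iu' ha' hu' nuE' nE']]]]] := addgens1_homogeneous gI hf hn' In'.
  by exists 0, x; rewrite mul0r addr0; split=> //; exists nu', n', g'.
(* [b] is the quotient of the cofactors, (a'/g') / (a/g), so the multiples of [f] cancel in
   [x - b * e]. *)
have [b hb] : exists b : S, germ b (t' + nu)%MM (a' * g) (a * g').
  apply: exists_germ; [exact: homogM| |exact: pt_mul].
  have -> : (t' + nu = t + nu')%MM by rewrite nuE nuE' !addmA [(t' + t)%MM]addmC.
  exact: homogM.
exists b, (x - b * e); split; last by rewrite subrK.
do 3 eexists; split; first exact: germD hx (germN (germM hb he)).
rewrite nE nE' (_ : _ + _ = (a * g' * g) * u' - (a' * g * g') * u); last by ring.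
by apply: idealB; exact: idealM.
Qed.

Lemma local_ideal_step I mu f : J `<=` I -> homogeneous mu f -> colon I f = y ->
  ~ (local_ideal y (addgens I [:: f]) `<=` local_ideal y I).
Proof.
move=> JI hf colonE sub.
have [t ht yt] := relevant_homogeneous mu (pt_prime y) (@pt_relevant _ _ _ _ y).
have [x hx] := exists_germ hf ht yt.
have /sub/(local_idealP JI hx)[nu [s [_ ys Isf]]] : local_ideal y (addgens I [:: f]) x.
  by exists mu, f, t; split=> //; exact: mem_addgens1.
by apply: ys; rewrite -colonE.
Qed.

(** A prime contained in [y] is relevant because [y] is, hence is a point; minimality of [y] then
    makes it equal to [y]. *)
Lemma colon_sub_pt I mu f : graded_ideal I -> J `<=` I -> homogeneous mu f ->
  prime_ideal (colon I f) -> colon I f != y -> ~ (colon I f `<=` y).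
Proof.
move=> gI JI hf pf /eqP ne sub; apply: ne; apply: y_minimal => //; split=> //.
- exact: graded_colon hf.
- by move=> N; apply: (@pt_relevant _ _ _ _ y); exact: subset_trans sub.
- by apply: subset_trans JI _; exact: sub_colon.
Qed.

Lemma stalk_chain I s : pfilt I s -> J `<=` I -> exists C : nat -> ideal S,
  C 0%N = local_ideal y I /\
  forall i, (i < count_mem (y : ideal A) s)%N -> C i `<=` C i.+1 /\ ~ (C i.+1 `<=` C i).
Proof.
elim=> {I s}[I _|I mu f s gI hf pf _ IH] JI; first by exists (fun=> local_ideal y I).
have [|C [C0 CS]] := IH; first by apply: subset_trans JI _; exact: sub_addgens.
rewrite /=; have [cE|ne] := eqVneq (colon I f) y.
  exists (fun i => if i is i'.+1 then C i' else local_ideal y I); split=> // -[_|i].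
    rewrite C0; split; last exact: local_ideal_step hf cE.
    by apply: local_ideal_sub; exact: sub_addgens.
  by rewrite add1n ltnS; exact: CS.
exists C; rewrite add0n; split=> //; rewrite C0; apply: ideal_ext => x; split.
  by apply: local_ideal_notin => //; [exact: graded_colon hf|exact: colon_sub_pt hf pf ne].
by apply: local_ideal_sub; exact: sub_addgens.
Qed.

(* The rank counts the steps of the filtration at which an ideal grows. *)
Lemma stalk_rank I s : pfilt I s -> J `<=` I -> exists rk : ideal S -> nat,
  [/\ forall D, (rk D <= count_mem (y : ideal A) s)%N,
      forall D E : ideal S, D `<=` E -> (rk D <= rk E)%N &
      forall D E : ideal S, D `<=` E -> rk D = rk E ->
        (forall x, local_ideal y I x -> E x -> D x) -> E `<=` D].
Proof.
elim=> {I s}[I I1|I mu f s gI hf pf _ IH] JI.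
  exists (fun=> 0%N); split=> // D E _ _ h x Ex.
  by apply: h => //; exact: local_ideal_full.
have [|rk [rk_le rk_mono rk_eq]] := IH.
  by apply: subset_trans JI _; exact: sub_addgens.
rewrite /=; have [cE|ne] := eqVneq (colon I f) y; last first.
  exists rk; split=> // D E DE rkE h; apply: rk_eq => // x Ix Ex; apply: h => //.
  by apply: (local_ideal_notin JI gI _ _ Ix);
    [exact: graded_colon hf|exact: colon_sub_pt hf pf ne].
(* [jump D] says that [D] has a nonzero image in the simple quotient at this step. *)
pose jump (D : ideal S) := exists x, [/\ D x, local_ideal y (addgens I [:: f]) x &
  ~ local_ideal y I x].
have jump_mono (D E : ideal S) : D `<=` E -> (`[< jump D >] <= `[< jump E >])%N.
  move=> DE; case: asboolP => // -[x [Dx Ix nIx]].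
  by case: asboolP => // -[]; exists x; split=> //; exact: DE.
exists (fun D => `[< jump D >] + rk D)%N; split=> [D|D E DE|D E DE rkE h].
- by apply: leq_add; [exact: leq_b1|exact: rk_le].
- by apply: leq_add; [exact: jump_mono|exact: rk_mono].
have [jE rkE'] : `[< jump D >] = `[< jump E >] /\ rk D = rk E.
  have := jump_mono _ _ DE; have := rk_mono _ _ DE; move: rkE.
  by case: `[< jump D >]; case: `[< jump E >]; lia.
apply: rk_eq => // x Ix Ex; have [Ix'|nIx] := pselect (local_ideal y I x); first exact: h.
have /asboolP[e [De Ie nIe]] : `[< jump D >] by rewrite jE; apply/asboolP; exists x.
have [a [c [Ic xE]]] := local_ideal_cyclic JI gI hf cE Ie nIe Ix.
rewrite xE; apply: idealD; last exact: idealM.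
apply: h => //; rewrite (_ : c = x - a * e); last by rewrite xE addrK.
by apply: idealB => //; apply: idealM; exact: DE.
Qed.

Lemma stalk_length s : pfilt J s -> ring_length S (count_mem (y : ideal A) s).
Proof.
move=> hs; split.
  have [C [_ CS]] := stalk_chain hs (@subset_refl _ _).
  exists (fun i => C i : set _); split=> i hi; first by exists (C i).
  by have [h1 h2] := CS i hi; split.
move=> m C [CI CS]; have [rk [rk_le rk_mono rk_eq]] := stalk_rank hs (@subset_refl _ _).
(* Beyond [m] the chain is unconstrained; any ideal serves as default there. *)
have /choice[D DE] : forall i, exists D : ideal S, (i <= m)%N -> C i = D.
  move=> i; have [im|_] := leqP i m; first by have [D ->] := CI i im; exists D.
  by exists (local_ideal y J).
have strict i : (i < m)%N -> (rk (D i) < rk (D i.+1))%N.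
  move=> im; have [sub nsub] := CS i im; rewrite (DE _ im) (DE _ (ltnW im)) in sub nsub.
  rewrite ltn_neqAle rk_mono // andbT; apply/eqP => e; apply: nsub.
  by apply: rk_eq => // x /local_ideal0-> _; exact: ideal0.
apply: leq_trans (rk_le (D m)).
suff le_rk i : (i <= m)%N -> (i <= rk (D i))%N by exact: le_rk.
elim: i => // i IH im; apply: leq_ltn_trans (strict i im); exact: IH (ltnW im).
Qed.

Lemma germD_same x x' nu f f' g : germ x nu f g -> germ x' nu f' g ->
  germ (x + x') nu (f + f') g.
Proof.
move=> [hf hg yg [z zE ->]] [hf' _ _ [z' zE' ->]]; split=> //; first exact: homogeneousD.
exists (z + z'); last by rewrite stalk_piD.
rewrite (_ : ambient_val (z + z') = ambient_val z + ambient_val z') //.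
by rewrite zE zE' tofracD mulrDl.
Qed.

Lemma germ_scale c x nu f g : germ x nu f g ->
  germ (stalk_scalar y c * x) nu (c%:MP * f) g.
Proof.
move=> hx; have := germM (germ_scalar y c) hx.
by rewrite add0m mul1r.
Qed.

Lemma germ_sum n (c : 'I_n -> k) (B : 'I_n -> S) nu (b : 'I_n -> A) t :
  homogeneous nu t -> ~ y t -> (forall i, germ (B i) nu (b i) t) ->
  germ (\sum_i stalk_scalar y (c i) * B i) nu (comb b c) t.
Proof.
move=> ht yt hB; rewrite /comb.
elim/big_rec2: _ => [|i f x _ hx]; last by apply: germD_same => //; exact: germ_scale.
split=> //; first exact: homogeneous0.
by exists 0; [rewrite tofrac0 mul0r|rewrite /stalk_pi !piE].
Qed.

(** A basis of [A/y]_nu in a large degree, divided by one form [t] of degree [nu] outside [y], is a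
    basis of the residue field. *)
Lemma stalk_residue_degree n : eventually (fun nu => hilb y nu = n) ->
  residue_degree (@stalk_scalar _ _ _ J y) n.
Proof.
move=> [nu hnu].
have hilb_nu : hilb y nu = n by rewrite -[nu]addm0.
have [b [hb sb ib]] := hilb_basis y nu; rewrite hilb_nu in b hb sb ib.
have [t ht yt] := relevant_homogeneous nu (pt_prime y) (@pt_relevant _ _ _ _ y).
have /choice[B hB] : forall i, exists x : S, germ x nu (b i) t.
  by move=> i; exact: exists_germ.
exists B; split=> // u _; have [mu [f [g hu]]] := germ_exists u.
have [hf hg yg _] := hu.
have nonunitE (c : {ffun 'I_n -> k}) :
    nonunits (u - \sum_i stalk_scalar y (c i) * B i) <-> y (f * t - comb b c * g).
  rewrite -mulNr; apply: (nonunits_germ (nu := (mu + nu)%MM) (g := g * t)).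
  by apply: germD hu _; apply: germN; exact: germ_sum.
(* Multiplication by [g] is injective on A/y between components of equal dimension [n], hence onto;
   so [f * t] is a multiple of [g] modulo [y]. *)
have full : full_in (addgens y [:: g]) (nu + mu)%MM.
  apply/hilb_full; have := hilb_prime_mul nu (pt_prime y) (@pt_graded _ _ _ _ y) hg yg.
  by rewrite hnu hilb_nu; lia.
have [c Ic] : exists c : {ffun 'I_n -> k}, y (f * t - comb b c * g).
  have htf : homogeneous (nu + mu)%MM (f * t) by rewrite mulrC; exact: homogM.
  have sb' a : homogeneous nu a -> exists c : {ffun 'I_n -> k}, y (a - comb b c).
    move=> /sb[c hc]; exists [ffun i => c i].
    by rewrite (_ : comb b _ = comb b c) //; congr comb; apply/funext => i; rewrite ffunE.
  have [Iff|[v [a [t' [Iv ha _ nuE ->]]]]] :=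
      addgens1_homogeneous (@pt_graded _ _ _ _ y) hg htf (full _ htf).
    have [c hc] := sb' 0 (@homogeneous0 _ _ _ nu); exists c.
    apply: idealB => //; apply: idealMr; rewrite -[comb b c]opprK; apply: idealN.
    by rewrite -sub0r.
  have e : t' = nu by apply: (@addIm _ mu).
  rewrite e in ha; have [c hc] := sb' a ha; exists c.
  by rewrite -addrA -mulrBl; apply: idealD => //; exact: idealMr.
exists c; split=> [|c' /nonunitE Ic']; first exact/nonunitE.
apply/ffunP => i; apply/eqP; rewrite -subr_eq0; apply/eqP.
move: i; apply: (ib (fun i => c i - c' i)).
have -> : comb b (fun i => c i - c' i) = comb b c - comb b c'.
  rewrite /comb -sumrB; apply: eq_bigr => i _.
  by rewrite mpolyCB mulrBl.
have [|//|//] := (pt_prime y).2 (comb b c - comb b c') g.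
rewrite (_ : _ * g = (f * t - comb b c' * g) - (f * t - comb b c * g)); last by ring.
exact: idealB.
Qed.

End LocalRing.

(** * Summation over the points and the final comparison *)

Section Degree.
Variables (k : fieldType) (r : nat) (d : 'I_r -> nat).
Local Notation A := (multiring k d).
Implicit Types (nu mu : 'X_{1..r}) (f g h : A) (I J K p q : ideal A).

Lemma multiproj_ext J (q q' : multiproj J) : pt_ideal q = pt_ideal q' -> q = q'.
Proof.
case: q q' => [p a b c e] [p' a' b' c' e'] /= pp'; subst p'.
by congr MultiProj; exact: Prop_irrelevance.
Qed.

(** As long as the primes met are not inside [q], the generators [f] lie in [q], which cannot go on
    up to the unit ideal. Hence the filtration sees every point. *)
Lemma pfilt_sub_prime I s q : pfilt I s -> prime_ideal q -> I `<=` q ->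
  exists2 p, p \in s & p `<=` q.
Proof.
move=> hs pq; elim: hs => {I s}[I I1 /(_ _ I1)|I mu f s _ _ _ _ IH Iq].
  by have [] := pq.
have [fq|nfq] := pselect (colon I f `<=` q); first by exists (colon I f); rewrite ?mem_head.
have [|p ps pq'] := IH; last by exists p; rewrite // inE ps orbT.
have [a Iaf nqa] : exists2 a, colon I f a & ~ q a.
  by apply: contrapT => no; apply: nfq => a Ia; apply: contrapT => nqa; apply: no; exists a.
have qf : q f by have [] := pq.2 a f (Iq _ Iaf).
by move=> x /addgens1P[u [b [Iu ->]]]; apply: idealD; [exact: Iq|exact: idealM].
Qed.

Lemma scheme_degree_hilb J : graded_ideal J ->
  (forall p q, point J p -> point J q -> p `<=` q -> p = q) ->
  exists2 e, eventually (fun nu => hilb J nu = e) & scheme_degree J e.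
Proof.
move=> gJ ptJ; have [s hs] := pfilt_exists gJ.
have rel_point p : p \in s -> relevant p -> point J p.
  by move=> ps rp; have [gp pp Jp] := pfilt_mem hs ps.
have /choice[w hw] : forall p, exists n, point J p -> eventually (fun nu => hilb p nu = n).
  move=> p; have [ptp|nptp] := pselect (point J p); last by exists 0%N.
  have [pp gp rp Jp] := ptp; have [|n hn] := hilb_maximal_point gp pp rp; last by exists n.
  move=> q [pq gq rq pq']; apply: ptJ => //; split=> //; exact: subset_trans pq'.
exists (\sum_(p <- s | `[< relevant p >]) w p)%N.
  by apply: hilb_pfilt => // p ps rp; apply: hw; exact: rel_point.
pose s' := [seq p <- s | `[< relevant p >]]; pose L := undup s'.
have L_point p : p \in L -> point J p.
  by rewrite mem_undup mem_filter => /andP[/asboolP rp ps]; exact: rel_point.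
have /choice[y yE] : forall i : 'I_(size L), exists q : multiproj J, pt_ideal q = nth J L i.
  move=> i; have [pp gp rp Jp] := L_point _ (mem_nth J (ltn_ord i)).
  by exists (MultiProj pp gp rp Jp).
have y_point (q : multiproj J) : point J q.
  split; [exact: pt_prime|exact: pt_graded|exact: pt_relevant|exact: pt_sub].
have y_min (q : multiproj J) p : point J p -> p `<=` q -> p = q.
  by move=> ptp; apply: ptJ.
exists (size L), y, (fun i => w (y i)), (fun i => count_mem (y i : ideal A) s); split.
- have /choice[z zE] : forall q : multiproj J, exists i, y i = q.
    move=> q; have [p ps pq] := pfilt_sub_prime hs (pt_prime q) (@pt_sub _ _ _ _ q).
    have rp : relevant p by move=> N; apply: (@pt_relevant _ _ _ _ q); exact: subset_trans pq.
    have e : p = q by apply: y_min => //; exact: rel_point.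
    have pL : p \in L by rewrite mem_undup mem_filter ps andbT; apply/asboolP.
    have lt : (index p L < size L)%N by rewrite index_mem.
    by exists (Ordinal lt); apply: multiproj_ext; rewrite yE nth_index.
  exists z => // i; apply: val_inj; apply/eqP.
  by rewrite -(nth_uniq J (ltn_ord _) (ltn_ord _) (undup_uniq _)) -!yE zE.
- by move=> i; apply: stalk_residue_degree; exact: hw.
- by move=> i; apply: stalk_length => // q; exact: y_min.
(* Equal primes are collected, so that each contributes its residue degree times its multiplicity;
   filtering by relevance leaves the multiplicity of a point unchanged. *)
rewrite -big_filter -/s' -big_undup_iterop_count -/L (big_nth J) big_mkord.
apply: eq_bigr => i _; rewrite -yE Monoid.iteropE iter_addn_0; congr (_ * _)%N.
rewrite count_filter; apply: eq_count => p /=; apply: andb_idr => /eqP->.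
by apply/asboolP; exact: pt_relevant.
Qed.

Lemma graded_addgens J is_ zs : graded_ideal J -> linear_seq is_ zs ->
  graded_ideal (addgens J zs).
Proof.
elim: zs J is_ => [|z zs IH] J is_ gJ lin; first by rewrite addgens_nil.
have [i [is' [_ hz lin']]] := linear_cons lin.
by rewrite addgens_cons; apply: IH lin'; exact: graded_addgens1 hz.
Qed.

Lemma hyperplane_linear (n : 'X_{1..r}) (h : forall i : 'I_r, 'I_(n i) -> A) :
  (forall i j, homogeneous U_(i)%MM (h i j)) ->
  exists is_, [/\ linear_seq is_ (hyperplane_seq h), (\sum_(i <- is_) U_(i))%MM = n &
    size (hyperplane_seq h) = mdeg n].
Proof.
(* Pairing each form with its direction yields both lists from one enumeration. *)
move=> hh; pose ps := [seq (i, h i j) | i <- enum 'I_r, j <- enum 'I_(n i)].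
have zsE : hyperplane_seq h = [seq x.2 | x <- ps].
  by rewrite /hyperplane_seq /ps map_allpairs.
have sumE : (\sum_(x <- ps) U_(x.1))%MM = n.
  rewrite big_allpairs_dep /= [RHS]multinomUE_id big_enum /=.
  apply: eq_bigr => i _; rewrite big_enum /=; apply/mnmP => j.
  by rewrite mnm_sumE sum_nat_const card_ord mulmnE mulnC.
exists [seq x.1 | x <- ps]; split; last 1 first.
- by rewrite zsE size_map -sumE mdeg_sum (eq_bigr (fun=> 1%N)) ?sum1_size // => x _; rewrite mdeg1.
- split=> [|l i0]; rewrite zsE ?size_map // => lt.
  rewrite (nth_map (i0, 0)) // (nth_map (i0, 0)) //.
  by have /allpairsPdep[i [j [_ _ ->]]] := mem_nth (i0, 0) lt; exact: hh.
- by rewrite big_map.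
Qed.

End Degree.

Theorem theorem4p7 (k : fieldType) (r : nat) (d : 'I_r -> nat)
    (J : ideal (multiring k d)) (n : 'X_{1..r})
    (h : forall i : 'I_r, 'I_(n i) -> multiring k d) :
  graded_ideal J ->
  dim_multiproj J (mdeg n) ->
  (forall i j, homogeneous U_(i)%MM (h i j)) ->
  filter_regular_seq J (hyperplane_seq h) ->
  exists2 e : nat,
    multidegree J n e%:R & scheme_degree (addgens J (hyperplane_seq h)) e.
Proof.
move=> gJ dimJ hh hreg; have [is_ [lin sumE sizeE]] := hyperplane_linear hh.
rewrite -sizeE in dimJ.
have [e ev degE] := scheme_degree_hilb (graded_addgens gJ lin)
  (filter_regular_points gJ dimJ lin hreg).
have [s evs] := hilb_binomial_type gJ.
have [t evt tE] := hilb_filter_regular_seq gJ lin hreg evs.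
exists e => //; suff <- : s@_n = e%:R by exact: multidegree_beval.
(* After the cuts the Hilbert function is eventually both [e] and [beval nu t], so [t] is the
   constant [e]; its constant coefficient is the coefficient of [s] at [n]. *)
have : t - (e%:R)%:MP = 0.
  apply: beval_unique; apply: eventually_imp (eventually_and ev evt) => nu [e1 e2].
  by rewrite bevalB bevalC -e2 e1 subrr.
move=> /eqP; rewrite subr_eq0 => /eqP te.
by rewrite -sumE -[X in s@_X]add0m -tE te mcoeffC eqxx mulr1.
Qed.
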